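(* Every planar $3$-tree has track number at most $25$.
   Context: A $k$-tree is defined recursively: the complete graph $K_k$ is a $k$-tree, and adding to a $k$-tree a new vertex adjacent to all vertices of some $k$-clique yields a $k$-tree; a planar $3$-tree is a $3$-tree that is planar. A $t$-track assignment of a graph $G$ is a partition of $V(G)$ into $t$ sets $V_1,\dots,V_t$ (tracks), each an independent set of $G$, together with a total order $<_i$ on each $V_i$. An X-crossing consists of two edges $(u,v)$ and $(x,y)$ with $u,x\in V_i$, $v,y\in V_j$ ($i\neq j$), $u<_i x$ and $y<_j v$. A $t$-track layout is a $t$-track assignment with no X-crossing; the track number $\mathrm{tn}(G)$ is the minimum $t$ for which $G$ has a $t$-track layout. *)

(* Defs.v *)
From HB Require Import structures.
From mathcomp Require Import all_boot all_order all_fingroup.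
Set Implicit Arguments. Unset Strict Implicit. Unset Printing Implicit Defensive.

(* A simple graph: vertex set = finite type T, adjacency e : rel T,
   assumed symmetric and irreflexive (hypotheses of the theorem). *)

Definition clique (T : finType) (e : rel T) (C : {set T}) : Prop :=
  forall u v, u \in C -> v \in C -> u != v -> e u v.

Inductive ktree_on (T : finType) (e : rel T) (k : nat) : {set T} -> Prop :=
  | ktree_base (A : {set T}) :
      #|A| = k -> clique e A -> ktree_on e k A
  | ktree_step (A C : {set T}) (v : T) :
      ktree_on e k A -> v \notin A -> C \subset A -> #|C| = k -> clique e C ->
      (forall u, u \in A -> e v u = (u \in C)) ->
      ktree_on e k (v |: A).

Definition ktree (T : finType) (e : rel T) (k : nat) : Prop :=
  ktree_on e k [set: T].

Definition swapd (T : finType) (d : T * T) : T * T := (d.2, d.1).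
Lemma swapdK (T : finType) : involutive (@swapd T).
Proof. by case. Qed.
Definition swap_perm (T : finType) : {perm (T * T)} :=
  perm (can_inj (@swapdK T)).

Definition dart (T : finType) (e : rel T) (d : T * T) : bool := e d.1 d.2.

Definition rotation_system (T : finType) (e : rel T) (sigma : {perm (T * T)}) : Prop :=
  (forall d, dart e d -> dart e (sigma d) /\ (sigma d).1 = d.1) /\
  (forall d d', dart e d -> dart e d' -> d.1 = d'.1 -> d' \in porbit sigma d).

Definition n_faces (T : finType) (e : rel T) (sigma : {perm (T * T)}) : nat :=
  #|[set porbit (swap_perm T * sigma)%g d | d in [set d | dart e d]]|.

Definition n_darts (T : finType) (e : rel T) : nat := #|[set d | dart e d]|.
Definition n_isolated (T : finType) (e : rel T) : nat :=
  #|[set v : T | [forall u, ~~ e v u]]|.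
Definition n_components (T : finType) (e : rel T) : nat := n_comp e predT.

(* A graph is planar iff it admits a rotation system of genus 0 on every
   component, i.e. V - E + F = 2 * (#components), where an isolated vertex
   counts as having one face.  (#darts = 2E.) *)
Definition planar (T : finType) (e : rel T) : Prop :=
  exists sigma : {perm (T * T)}, rotation_system e sigma /\
    2 * (#|T| + n_faces e sigma + n_isolated e) = n_darts e + 4 * n_components e.

Definition planar_3tree (T : finType) (e : rel T) : Prop :=
  ktree e 3 /\ planar e.

(* A t-track assignment: tr assigns each vertex a track in 'I_t; each track
   is independent; the total order <_i on track i is given by
   pos (injective on each track): u <_i x  iff  pos u < pos x. *)
Definition track_assignment (T : finType) (e : rel T) (t : nat)
    (tr : T -> 'I_t) (pos : T -> nat) : Prop :=
  (forall u v, e u v -> tr u != tr v) /\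
  (forall u v, tr u = tr v -> pos u = pos v -> u = v).

Definition X_crossing (T : finType) (e : rel T) (t : nat)
    (tr : T -> 'I_t) (pos : T -> nat) (u v x y : T) : Prop :=
  e u v /\ e x y /\ tr u = tr x /\ tr v = tr y /\ tr u != tr v /\
  pos u < pos x /\ pos y < pos v.

Definition track_layout (T : finType) (e : rel T) (t : nat) : Prop :=
  exists (tr : T -> 'I_t) (pos : T -> nat),
    track_assignment e tr pos /\
    forall u v x y, ~ X_crossing e tr pos u v x y.

Definition track_number_le (T : finType) (e : rel T) (t : nat) : Prop :=
  exists2 s, s <= t & track_layout e s.

(* Main.v *)
From HB Require Import structures.
Require Import Defs.
From mathcomp Require Import all_boot all_order all_fingroup.
From mathcomp Require Import all_algebra.
From mathcomp Require Import zify lra.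

(** In a planar 3-tree Euler's formula forces every face to be a triangle, and
    deleting the last stacked vertex leaves a triangulation; hence no triangle
    has three common neighbours, i.e. every face is stacked at most once.  So
    the graph embeds into a universal planar 3-tree, obtained by stacking a
    vertex into every face forever.

    The universal graph splits into components of equal distance to the base
    triangle.  Each component is outerplanar and is attached to one triangle of
    a component of the previous distance.  A component is laid out on integer
    levels so that every triangle occupies three consecutive levels: vertices
    are ordered along the outer cycle, and a vertex stacked on an edge whose
    lower end has level [s] gets level [s + 1] or [s + 2].  Everything below a
    chord has a level above the lower end of the chord, so there is no
    X-crossing, and since edges span at most two levels, levels may be taken
    modulo 5.

    Triangles with lowest level [s] are put into two classes according to the
    parity of [s / 2].  Within a class they are linearly ordered in a way that
    is monotone on every track, so components attached to triangles of one
    class can be placed in that order without crossings.  Five palettes of five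
    tracks suffice: a component on palette [p] has its children on the palettes
    [p + 1] and [p + 2] modulo 5, according to the class.  This is a regular
    tournament, so edges between two palettes all go from parent to child in
    the same direction. *)

Set Implicit Arguments. Unset Strict Implicit. Unset Printing Implicit Defensive.
Import Order.TTheory GRing.Theory Num.Theory.

(** * Common neighbours of triangles in planar 3-trees *)

Lemma add_bools_le2 (m : nat) (p q : bool) : m <= 1 -> ~ (p /\ q) -> m + p + q <= 2.
Proof. by case: p; case: q => //= m1 npq; [case: npq|lia|lia|lia]. Qed.

Section Triangulation.
Variables (T : finType) (e : rel T).
Hypotheses (e_sym : symmetric e) (e_irr : irreflexive e).

Lemma edge_neq x y : e x y -> x != y.
Proof. by apply: contraTneq => ->; rewrite e_irr. Qed.

Lemma card_set3 (x y z : T) : x != y -> y != z -> z != x -> #|[set x; y; z]| = 3.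
Proof.
move=> xy yz zx; rewrite setUC cardsU1 cards2 xy !inE negb_or (negPf zx) eq_sym.
by rewrite (negPf yz).
Qed.

(* [f x y] is the third vertex of the face to which the dart [(x, y)] belongs;
   the second clause says that the faces around a vertex form a single cycle. *)
Definition triangulation (A : {set T}) (f : T -> T -> T) :=
  (forall x y, x \in A -> y \in A -> e x y ->
     [/\ f x y \in A, e y (f x y) & f y (f x y) = x]) /\
  (forall u (S : {set T}), u \in A -> S != set0 -> (forall x, x \in S -> x \in A /\ e u x) ->
     (forall x, x \in S -> f x u \in S) -> forall x, x \in A -> e u x -> x \in S).

Definition cnbrs (A : {set T}) x y z := [set w in A | [&& e w x, e w y & e w z]].

(** The map [x => f x v] sends [C] to itself without fixed points, and a nonempty set closed under
    it is all of [C]. On three points it is a 3-cycle, which names [a], [b] and [c]. *)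
Lemma remove_vertex (A C : {set T}) v f : v \notin A -> C \subset A -> #|C| = 3 ->
  (forall u, u \in A -> e v u = (u \in C)) -> triangulation (v |: A) f ->
  exists a b c, [/\ [/\ a != b, b != c, c != a & C = [set a; b; c]],
    [/\ f a v = b, f b v = c & f c v = a],
    [/\ f v a = c, f v b = a & f v c = b] &
    [/\ f b a = v, f c b = v & f a c = v]].
Proof.
move=> vA CA C3 ev [V1 V2].
have inA x : x \in C -> x \in v |: A by move=> xC; rewrite !inE (subsetP CA) ?orbT.
have vv : v \in v |: A by rewrite setU11.
have eC x : x \in v |: A -> e v x -> x \in C.
  by move=> /setU1P[->|xA]; [rewrite e_irr|rewrite ev].
have evC x : x \in C -> e v x by move=> xC; rewrite ev // (subsetP CA).
have next x : x \in C -> [/\ f x v \in C, f v (f x v) = x, f (f x v) x = v & e (f x v) x].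
  move=> xC; have [i1 e1 f1] := V1 x v (inA _ xC) vv (etrans (e_sym _ _) (evC _ xC)).
  have [i2 e2 f2] := V1 v (f x v) vv i1 e1; rewrite f1 in e2 f2.
  by split => //; apply: eC.
have [a aC] : exists a, a \in C by apply/set0Pn; rewrite -card_gt0 C3.
set b := f a v; set c := f b v.
have [bC fvb fba eba] := next a aC; rewrite -/b in bC fvb fba eba.
have [cC fvc fcb ecb] := next b bC; rewrite -/c in cC fvc fcb ecb.
have [dC fvd fdc edc] := next c cC.
have ca : c != a.
  apply/eqP => ca; have sub x : x \in C -> x \in [set a; b].
    move=> xC; apply: (V2 v) => //; rewrite ?inA ?evC //.
    - by apply/set0Pn; exists a; rewrite !inE eqxx.
    - by move=> y /set2P[] ->; rewrite inA // evC.
    - by move=> y /set2P[] ->; rewrite -?/b -?/c ?ca !inE eqxx ?orbT.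
  by have /subset_leq_card : C \subset [set a; b] := introT subsetP sub; rewrite C3 cards2; case: (a != b).
have ab : a != b by rewrite eq_sym edge_neq.
have bc : b != c by rewrite eq_sym edge_neq.
have EC : C = [set a; b; c].
  by apply/esym/eqP; rewrite eqEcard C3 card_set3 // !subUset !sub1set aC bC cC.
have fcv : f c v = a.
  move: dC; rewrite EC !inE => /orP[/orP[] /eqP //|/eqP E]; last first.
    by rewrite E e_irr in edc.
  by move=> E; rewrite E fvb in fvd; rewrite fvd eqxx in ca.
rewrite fcv in fvd fdc.
by exists a, b, c.
Qed.

(** Counting the sides that are faces makes the bound inductive: stacking [v] into a face of [C]
    trades one face for one common neighbour. *)
Lemma common_nbrs_faces (A : {set T}) : ktree_on e 3 A -> forall f, triangulation A f ->
  forall x y z, x \in A -> y \in A -> z \in A -> e x y -> e y z -> e z x ->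
  #|cnbrs A x y z| + (f x y == z) + (f x z == y) <= 2.
Proof.
elim=> {A} [A A3 cA f _ x y z xA yA zA exy eyz ezx|A C v _ IH vA CA C3 cC ev f tf x y z].
  suff -> : cnbrs A x y z = set0 by rewrite cards0; case: eqP; case: eqP.
  apply/setP => w; rewrite !inE; apply/negP => /and4P[wA ewx ewy ewz].
  have /subset_leq_card : w |: [set x; y; z] \subset A.
    by rewrite !subUset !sub1set wA xA yA zA.
  rewrite A3 cardsU1 card_set3 ?edge_neq // !inE !negb_or.
  by rewrite (edge_neq ewx) (edge_neq ewy) (edge_neq ewz).
have [a [b [c [[ab bc ca EC] [fav fbv fcv] [fva fvb fvc] [fba fcb fac]]]]] :=
  remove_vertex vA CA C3 ev tf.
have [V1 V2] := tf.
have inC x' : (x' \in C) = [|| x' == a, x' == b | x' == c] by rewrite EC !inE orbA.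
have aC : a \in C by rewrite inC eqxx.
have bC : b \in C by rewrite inC eqxx orbT.
have cinC : c \in C by rewrite inC eqxx !orbT.
have [aA bA cA] : [/\ a \in A, b \in A & c \in A] by split; apply: (subsetP CA).
have [ba cb ac] : [/\ b != a, c != b & a != c] by split; rewrite eq_sym.
have [av bv cv] : [/\ a != v, b != v & c != v].
  by split; apply: contraNneq vA => <-.
have memA u : u \in A -> u \in v |: A by move=> uA; rewrite !inE uA orbT.
have vin : v \in v |: A by rewrite setU11.
have evC u : u \in v |: A -> e v u = (u \in C).
  case/setU1P=> [->|]; last exact: ev.
  by rewrite e_irr; apply/esym/negbTE; apply: contra vA; apply: subsetP.
(* Deleting [v] merges its three faces into one, bounded by the darts of [C] that bordered them. *)
pose f' x y := if (x == b) && (y == a) then c else if (x == c) && (y == b) then a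
   else if (x == a) && (y == c) then b else f x y.
have f'ba : f' b a = c by rewrite /f' !eqxx.
have f'cb : f' c b = a by rewrite /f' (negPf cb) !eqxx.
have f'ac : f' a c = b by rewrite /f' (negPf ab) (negPf ac) !eqxx.
have f'E x' y' : f x' y' != v -> f' x' y' = f x' y'.
  rewrite /f'; case: andP => [[/eqP-> /eqP->]|_]; first by rewrite fba eqxx.
  case: andP => [[/eqP-> /eqP->]|_]; first by rewrite fcb eqxx.
  by case: andP => [[/eqP-> /eqP->]|_] //; rewrite fac eqxx.
have fv x' y' : x' \in A -> y' \in A -> e x' y' -> f x' y' = v ->
    [\/ x' = b /\ y' = a, x' = c /\ y' = b | x' = a /\ y' = c].
  move=> xA yA exy fxy; have [_ eyv fyv] := V1 _ _ (memA _ xA) (memA _ yA) exy.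
  rewrite fxy in eyv fyv; move: eyv; rewrite e_sym evC ?memA // inC.
  case/or3P=> /eqP Ey; rewrite Ey in fyv *; rewrite ?fav ?fbv ?fcv in fyv; rewrite -fyv.
  + by constructor 1.
  + by constructor 2.
  + by constructor 3.
have eab : e b a by apply: cC.
have ebc : e c b by apply: cC.
have eca : e a c by apply: cC.
have tf' : triangulation A f'.
  split=> [x' y' xA yA exy|u S uA S0 SN Sf x' xA eux].
    have [fxy|fxy] := eqVneq (f x' y') v.
      by have [[-> ->]|[-> ->]|[-> ->]] := fv _ _ xA yA exy fxy; rewrite ?f'ba ?f'cb ?f'ac.
    have [] := V1 _ _ (memA _ xA) (memA _ yA) exy.
    rewrite f'E // => /setU1P[E|fA]; first by rewrite E eqxx in fxy.
    move=> efy ff; split => //; rewrite f'E ff //.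
    by apply: contraNneq vA => <-.
  (* [f'] skips [v] in the rotation around [u], so [v] is put back when [S] contains its
     predecessor. *)
  pose S' := S :|: [set w | (w == v) && [exists p in S, f p u == v]].
  have sub w : w \in S' -> w \in A -> w \in S.
    by rewrite !inE => /orP[//|/andP[/eqP-> _]]; rewrite (negPf vA).
  apply: sub => //; apply: (V2 u); rewrite ?memA //.
  - by case/set0Pn: S0 => p pS; apply/set0Pn; exists p; rewrite !inE pS.
  - move=> w; rewrite !inE => /orP[wS|/andP[/eqP-> /exists_inP[p pS /eqP fpu]]].
      by have [wA ->] := SN _ wS; rewrite wA orbT.
    have [pA eup] := SN p pS; rewrite eqxx /=.
    have [_ + _] := V1 p u (memA _ pA) (memA _ uA) (etrans (e_sym _ _) eup).
    by rewrite fpu.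
  - move=> w; rewrite !inE => /orP[wS|/andP[/eqP-> /exists_inP[p pS /eqP fpu]]].
      have [fwu|fwu] := eqVneq (f w u) v; last by rewrite -f'E // Sf.
      by rewrite orbC; apply/orP; left; apply/exists_inP; exists w; rewrite // fwu.
    have [pA eup] := SN p pS.
    have := Sf p pS; have [[-> ->]|[-> ->]|[-> ->]] :=
      fv _ _ pA uA (etrans (e_sym _ _) eup) fpu; rewrite ?f'ba ?f'cb ?f'ac ?fva ?fvb ?fvc => ->//.
have cyc p q r : p \in v |: A -> q \in v |: A -> e p q -> f p q = r -> f q r = p.
  by move=> pA qA epq <-; have [] := V1 p q pA qA epq.
have cnv p q : p \in C -> q \in C -> p != q -> #|cnbrs (v |: A) v p q| <= 1.
  move=> pC qC pq; have : #|C :\: [set p; q]| <= 1.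
    rewrite cardsD (_ : C :&: _ = [set p; q]) ?C3 ?cards2 ?pq //.
    by apply/setIidPr; rewrite subUset !sub1set pC.
  apply: leq_trans; apply/subset_leq_card/subsetP => w; rewrite !inE => /and4P[].
  move=> wA; rewrite e_sym evC ?inE // => -> ewp ewq.
  by rewrite andbT negb_or !edge_neq.
have nboth p q : p \in C -> q \in C -> f p v = q -> f q v = p -> False.
  rewrite !inC => /or3P[] /eqP-> /or3P[] /eqP->; rewrite ?fav ?fbv ?fcv => E1 E2; move: ab bc ca;
   by rewrite ?E1 ?E2 ?eqxx // -?E1 -?E2 ?eqxx.
move=> xA yA zA exy eyz ezx.
have exz : e x z by rewrite e_sym.
(* In a triangle through [v], only the third vertex of [C] can be a common neighbour, and by [nboth]
   at most one side is a face. *)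
have [Ex|xv] := eqVneq x v.
  subst x; have yC : y \in C by rewrite -evC.
  have zC : z \in C by rewrite -evC.
  apply: add_bools_le2; first by apply: cnv => //; apply: edge_neq.
  case=> /eqP fvy /eqP fvz; have fyz := cyc _ _ _ vin yA exy fvy.
  have fzy := cyc _ _ _ vin zA exz fvz.
  apply: (nboth y z) => //; first by apply: cyc fzy => //; rewrite e_sym.
  exact: cyc fyz.
have [Ey|yv] := eqVneq y v.
  subst y; have xC : x \in C by rewrite -evC // e_sym.
  have zC : z \in C by rewrite -evC.
  apply: add_bools_le2.
    apply: leq_trans (cnv x z xC zC (edge_neq exz)); apply/subset_leq_card/subsetP => w.
    by rewrite !inE => /and4P[-> -> -> ->].
  case=> /eqP fxv /eqP fxz; apply: (nboth x z) => //; exact: cyc fxz.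
have [Ez|zv] := eqVneq z v.
  subst z; have xC : x \in C by rewrite -evC.
  have yC : y \in C by rewrite -evC // e_sym.
  apply: add_bools_le2.
    apply: leq_trans (cnv x y xC yC (edge_neq exy)); apply/subset_leq_card/subsetP => w.
    by rewrite !inE => /and4P[-> -> -> ->].
  case=> /eqP fxy /eqP fxv; apply: (nboth x y) => //; exact: cyc fxy.
have toA w : w \in v |: A -> w != v -> w \in A by move=> /setU1P[->|//]; rewrite eqxx.
have {}xA := toA _ xA xv; have {}yA := toA _ yA yv; have {}zA := toA _ zA zv.
have := IH f' tf' x y z xA yA zA exy eyz ezx.
have [/and3P[xC yC zC]|nC] := boolP [&& x \in C, y \in C & z \in C]; last first.
  have -> : cnbrs (v |: A) x y z = cnbrs A x y z.
    apply/setP => w; rewrite !inE; case: eqP => //= ->.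
    by rewrite !ev // (negPf nC) (negPf vA).
  apply: leq_trans; rewrite -!addnA leq_add2l leq_add //; case: eqP => // fE;
    by rewrite f'E ?fE ?eqxx.
have -> : cnbrs (v |: A) x y z = v |: cnbrs A x y z.
  by apply/setP => w; rewrite !inE; case: eqP => //= ->; rewrite !ev // xC yC zC.
rewrite cardsU1 !inE (negPf vA) /= add1n.
have [xy [yz zx]] := (edge_neq exy, (edge_neq eyz, edge_neq ezx)).
have f'le p q r : r != v -> (f p q == r) <= (f' p q == r).
  by move=> rv; case: eqP => // fE; rewrite f'E ?fE ?eqxx.
(* Here the triangle is [C]. One of its sides is the merged face of [f'] and is lost in [f]; this
   pays for the common neighbour [v]. *)
have table : (f x y = v /\ f' x y = z) \/ (f x z = v /\ f' x z = y).
  move: xC yC zC xy yz zx; rewrite !inC.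
  by case/or3P=> /eqP-> /or3P[] /eqP->; rewrite ?eqxx // => /or3P[] /eqP-> _;
    rewrite ?eqxx // => _ _; [right|left|left|right|right|left].
case: table => -[fE f'E']; apply: leq_trans; rewrite fE f'E' eqxx [v == _]eq_sym.
  by rewrite (negPf zv) addn0 addn1 ltnS leq_add2l f'le.
by rewrite (negPf yv) addn0 addn1 addSn ltnS leq_add2l f'le.
Qed.
End Triangulation.

(** * Euler's formula and triangular faces *)

Section PlanarTriangulation.
Variables (T : finType) (e : rel T).
Hypotheses (e_sym : symmetric e) (e_irr : irreflexive e).

Definition nbr_in (A : {set T}) x := [set y in A | e x y].

Lemma ktree3_degrees (A : {set T}) : ktree_on e 3 A ->
  [/\ 2 < #|A|, forall x, x \in A -> 1 < #|nbr_in A x| &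
      \sum_(x in A) #|nbr_in A x| + 12 = 6 * #|A|].
Proof.
elim=> {A} [A A3 cA|A C v _ [A3 dA sA] vA CA C3 cC ev].
  have dA x : x \in A -> #|nbr_in A x| = 2.
    move=> xA; have -> : nbr_in A x = A :\ x.
      apply/setP => y; rewrite !inE andbC; have [->|yx] := eqVneq y x; first by rewrite e_irr.
      by case yA: (y \in A); rewrite ?andbF // cA // eq_sym.
    by have := cardsD1 x A; rewrite A3 xA add1n => -[].
  rewrite A3; split => // [x /dA -> //|].
  by rewrite (eq_bigr (fun=> 2)) // sum_nat_const A3.
have dv : #|nbr_in (v |: A) v| = 3.
  rewrite -C3; apply: eq_card => y; rewrite !inE; have [->|yv] := eqVneq y v.
    by rewrite e_irr; apply/esym/negbTE; apply: contra vA; apply: subsetP.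
  by case yA: (y \in A); rewrite /= ?ev //; apply/esym/negbTE; apply: contraFN yA => /(subsetP CA).
have dx x : x \in A -> #|nbr_in (v |: A) x| = (x \in C) + #|nbr_in A x|.
  move=> xA; rewrite (cardsD1 v) !inE eqxx e_sym ev //=; congr (_ + _).
  apply: eq_card => y; rewrite !inE; have [->|yv] := eqVneq y v; last by [].
  by rewrite (negPf vA).
split.
- by rewrite cardsU1 vA ltnW.
- move=> x /setU1P[->|xA]; first by rewrite dv.
  by rewrite dx //; apply: leq_trans (dA x xA) (leq_addl _ _).
rewrite big_setU1 //= dv (eq_bigr _ dx) big_split /= cardsU1 vA.
have -> : \sum_(i in A) (i \in C : nat) = 3.
  rewrite -C3 -sum1_card big_mkcond [RHS]big_mkcond /=; apply: eq_bigr => i _.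
  by case iC: (i \in C); rewrite ?if_same // (subsetP CA).
by move: sA; move: (\sum_(_ in _) _) #|A| => m n; lia.
Qed.

Hypothesis ktree_e : ktree e 3.

Lemma n_dartsE : n_darts e + 12 = 6 * #|T|.
Proof.
have [_ _] := ktree3_degrees ktree_e; rewrite cardsT => <-; congr (_ + _).
rewrite /n_darts -sum1_card (eq_bigl (fun d => e d.1 d.2)); last by move=> d; rewrite inE.
rewrite -(pair_big_dep xpredT (fun x y => e x y) (fun _ _ => 1)) /= .
apply: eq_big => [x|x _]; first by rewrite inE.
by rewrite sum1_card; apply: eq_card => y; rewrite !inE.
Qed.

Lemma two_nbrs x y : e x y -> exists2 z, e x z & z != y.
Proof.
move=> exy; have [_ /(_ x (in_setT x)) + _] := ktree3_degrees ktree_e.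
rewrite (cardsD1 y) !inE exy /= ltnS card_gt0 => /set0Pn[z]; rewrite !inE => /andP[zy /= exz].
by exists z.
Qed.

Lemma no_isolated : n_isolated e = 0.
Proof.
apply/eqP; rewrite cards_eq0; apply/eqP/setP => x; rewrite !inE; apply/negP => /forallP nx.
have [_ /(_ x (in_setT x)) + _] := ktree3_degrees ktree_e.
by rewrite ltnNge => /negP[]; rewrite leq_eqVlt ltnS leqn0 cards_eq0 orbC; apply/orP; left;
  apply/eqP/setP => y; rewrite !inE (negPf (nx y)).
Qed.

Lemma n_components_gt0 : 0 < n_components e.
Proof.
have [A3 _ _] := ktree3_degrees ktree_e; rewrite cardsT in A3.
have /card_gt0P[x _] : 0 < #|T| by apply: leq_trans A3.
apply/card_gt0P; exists (fingraph.root e x); rewrite !inE /= andbT.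
exact/roots_root/sym_connect_sym.
Qed.

Variable sigma : {perm (T * T)}.
Hypothesis rot : rotation_system e sigma.

Let phi := (swap_perm T * sigma)%g.

Lemma phiE x y : phi (x, y) = sigma (y, x).
Proof. by rewrite /phi permM permE. Qed.

Lemma phi_dart x y : e x y -> e y (phi (x, y)).2 /\ phi (x, y) = (y, (phi (x, y)).2).
Proof.
move=> exy; have [] := rot.1 (y, x); first by rewrite /dart /= e_sym.
by rewrite !phiE /dart; case: (sigma _) => a b /= eab E; rewrite -E.
Qed.

Lemma phi_porbit_dart d d' : dart e d -> d' \in porbit phi d -> dart e d'.
Proof.
move=> ed /porbitP[i ->]; elim: i => [|i]; first by rewrite expg0 perm1.
rewrite expgSr permM; case: ((phi ^+ i)%g d) => x y /= /phi_dart[exy ->].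
by rewrite /dart.
Qed.

(** A face of length one is a loop. A face of length two makes [sigma] fix a dart, whose tail then
    has degree one. *)
Lemma face_size d : dart e d -> 3 <= #|porbit phi d|.
Proof.
case: d => x y; rewrite /dart /= => exy.
have := iter_porbit phi (x, y).
have : 0 < #|porbit phi (x, y)| by apply/card_gt0P; exists (x, y); apply: porbit_id.
have [eyz phi1] := phi_dart exy.
case: #|_| => [|[|[|]]] //= _.
  by rewrite phi1 => -[E _]; rewrite E e_irr in exy.
have [_ phi2] := phi_dart eyz.
rewrite phi1 phi2 => -[zx _]; rewrite zx in phi1.
have [z eyz' zx'] : exists2 z, e y z & z != x by apply: two_nbrs; rewrite e_sym.
have : (y, z) \in porbit sigma (y, x) by apply: rot.2; rewrite /dart //= e_sym.
case/porbitP=> i; have -> : (sigma ^+ i)%g (y, x) = (y, x).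
  by elim: i => [|i IH]; rewrite ?expg0 ?perm1 // expgS permM -phiE phi1.
by case=> E; rewrite E eqxx in zx'.
Qed.

Lemma darts_faces : n_darts e =
  \sum_(B in [set porbit phi d | d in [set d | dart e d]]) #|B|.
Proof.
rewrite /n_darts -sum1_card (partition_big_imset (porbit phi)) /=.
apply: eq_bigr => B /imsetP[d]; rewrite inE => ed ->; rewrite sum1_card.
apply: eq_card => d'; rewrite -[LHS]topredE /= !inE eq_porbit_mem.
by apply/andP/idP => [[]//|dd']; rewrite dd' (phi_porbit_dart ed dd').
Qed.

Hypothesis euler : 2 * (#|T| + n_faces e sigma + n_isolated e) = n_darts e + 4 * n_components e.

(** With [2E = 6n - 12] and at least one component, Euler's formula gives [F >= 2n - 4], so
    [3F >= 2E]. The face sizes sum to [2E] and are at least 3, so none exceeds 3. *)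
Lemma face_size3 d : dart e d -> #|porbit phi d| = 3.
Proof.
move=> ed; apply/eqP; rewrite eqn_leq face_size // andbT leqNgt; apply/negP => big.
have := darts_faces; set F := [set _ | _ in _].
have dF : porbit phi d \in F by apply/imsetP; exists d; rewrite ?inE.
have : \sum_(B in F) 3 < \sum_(B in F) #|B|.
  rewrite (bigD1 _ dF) [X in _ < X](bigD1 _ dF) /= -addSn leq_add //.
  by apply: leq_sum => B /andP[/imsetP[d']]; rewrite inE => ed' -> _; apply: face_size.
rewrite sum_nat_const; move: euler; rewrite no_isolated {1}/n_faces -/phi -/F.
have := n_dartsE; have := n_components_gt0.
move: #|F| #|T| (n_darts e) (n_components e) (\sum_(_ in _) _) => nF nT nD nC sB h1 h2 h3 h4 h5.
by clear -h1 h2 h3 h4 h5; lia.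
Qed.

Lemma planar_triangulation : triangulation e [set: T] (fun x y => (phi (x, y)).2).
Proof.
split=> [x y _ _ exy|u S _ /set0Pn[x xS] SN Sf y _ euy].
  have [eyz phi1] := phi_dart exy; rewrite inE; split => //.
  have [ezw phi2] := phi_dart eyz; have [_ phi3] := phi_dart ezw.
  have := iter_porbit phi (x, y); rewrite face_size3 //= phi1 phi2 phi3.
  by case.
have [_ eux] := SN x xS.
have /porbitP[i] : (u, y) \in porbit sigma (u, x) by apply: rot.2.
suff [z zS ->] : exists2 z, z \in S & (sigma ^+ i)%g (u, x) = (u, z) by case=> ->.
elim: i => [|i [z zS IH]]; first by exists x; rewrite ?expg0 ?perm1.
have [_ euz] := SN z zS; exists (phi (z, u)).2; first exact: Sf.
rewrite expgSr permM IH -phiE; have [_ <-] := phi_dart (etrans (e_sym _ _) euz).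
by [].
Qed.

End PlanarTriangulation.

Lemma planar_3tree_common_nbrs (T : finType) (e : rel T) (C : {set T}) :
  symmetric e -> irreflexive e -> planar_3tree e -> #|C| = 3 -> clique e C ->
  #|[set v | [forall u in C, e v u]]| <= 2.
Proof.
move=> e_sym e_irr [kt [sigma [rot euler]]] C3 cC.
have := common_nbrs_faces e_sym e_irr kt (planar_triangulation e_sym e_irr kt rot euler).
have := enum_uniq C; have := mem_enum C; move: C3; rewrite cardE.
case: (enum C) => [|a [|b [|c [|]]]] //= _ mC /and3P[]; rewrite !inE => /norP[ab ac] bc _.
have [aC bC cC'] : [/\ a \in C, b \in C & c \in C] by rewrite -!mC !inE !eqxx !orbT.
move=> /(_ a b c); rewrite !inE !cC // 1?eq_sym // => /(_ isT isT isT isT isT isT).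
rewrite -addnA => /(leq_trans (leq_addr _ _)); apply: leq_trans.
apply/subset_leq_card/subsetP => w; rewrite !inE => /forall_inP wC.
by rewrite !wC.
Qed.

(** * A universal outerplanar graph and its layout of span two *)

Local Open Scope ring_scope.

Inductive dir := DL | DM | DR.

Definition nat_of_dir d := match d with DL => 0%N | DM => 1%N | DR => 2%N end.
Definition dir_of_nat n := match n with 0 => DL | 1 => DM | _ => DR end%N.
Lemma nat_of_dirK : cancel nat_of_dir dir_of_nat. Proof. by case. Qed.
HB.instance Definition _ := Countable.copy dir (can_type nat_of_dirK).

(* The head of an address is the last step, so descendants are extensions on
   the left. *)
Definition address := seq dir.
Definition leveled := (address * nat)%type.

(* A face, described by the vertices of the current component on its boundary,
   each with its level: none, one or two.  The numbers are the indices, in the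
   parent triangle of the component, of the remaining corners. *)
Inductive kind :=
| Root
| Slot of leveled & nat & nat
| Edge of leveled & leveled & nat.

(* The level completing [a] and [b] to three consecutive levels. *)
Definition third (a b : nat) : nat := (3 * minn a b + 3 - a - b)%N.

Definition level_of k : nat :=
  match k with
  | Root => 0
  | Slot c _ _ => c.2.+1
  | Edge l r _ => third l.2 r.2
  end%N.

(* The child [DM] of an [Edge] is a junk value: stacking on the face avoiding
   the parent triangle starts a new component instead. *)
Definition child k (v : leveled) d : kind :=
  match k, d with
  | Root, DL => Slot v 1 2
  | Root, DM => Slot v 0 2
  | Root, DR => Slot v 0 1
  | Slot c i _, DL => Edge c v i
  | Slot c i j, DM => Slot v i j
  | Slot c _ j, DR => Edge v c j
  | Edge l _ i, DL => Edge l v i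
  | Edge _ _ i, DM => Slot v i i
  | Edge _ r i, DR => Edge v r i
  end.

(** An address stands for a face and also for the vertex stacked into it; this is the face. *)
Fixpoint kind_at (a : address) : kind :=
  if a is d :: p then child (kind_at p) (p, level_of (kind_at p)) d else Root.

Definition level a := level_of (kind_at a).

Definition ends_of k : seq leveled :=
  match k with
  | Root => [::]
  | Slot c _ _ => [:: c]
  | Edge l r _ => [:: l; r]
  end.

Definition ends a : seq leveled := ends_of (kind_at a).

(** The intervals of radius 1/8 around the offsets are disjoint, avoid 0 and lie within [(-1, 1)].
    The outer cycle runs through [DL], the vertex itself, [DM], [DR]. *)
Definition offset d : rat :=
  match d with DL => - (1 / 2) | DM => 1 / 4 | DR => 3 / 4 end.

(* All descendants of [a] are placed at distance less than [radius a] of [pos a],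
   and everything else at distance at least [radius a]. *)
Fixpoint radius (a : address) : rat := if a is _ :: p then radius p / 8 else 1.
Fixpoint pos (a : address) : rat :=
  if a is d :: p then pos p + offset d * radius p else 0.

Lemma radius_gt0 a : 0 < radius a.
Proof. by elim: a => //= d p IH; lra. Qed.


Lemma suffix_splitP (p b : address) :
  suffix p b -> b = p \/ exists d, suffix (d :: p) b.
Proof.
move=> /suffixP[s ->]; case/lastP: s => [|s x]; [by left|right].
by exists x; rewrite -cats1 -catA /= suffix_suffix.
Qed.

Lemma suffix_consl (d : dir) (p b : address) : suffix (d :: p) b -> suffix p b.
Proof. by rewrite -cat1s; apply: catl_suffix. Qed.

Lemma suffix_cons_self (d : dir) (p : address) : suffix (d :: p) p = false.
Proof. by apply/negP => /size_suffix /=; rewrite ltnn. Qed.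

Lemma suffix_anti (a b : address) : suffix a b -> suffix b a -> a = b.
Proof.
move=> /suffixP[s ->] /suffixP[t] /(congr1 size); rewrite !size_cat.
by case: s => //= x s; lia.
Qed.

Lemma suffix_cons_inj (d d' : dir) (p b : address) :
  suffix (d :: p) b -> suffix (d' :: p) b -> d = d'.
Proof.
move=> /suffixP[s ->] /suffixP[t]; rewrite -!cat_rcons => E.
have sz : size (rcons s d) = size (rcons t d').
  by move/(congr1 size): E; rewrite !size_cat; lia.
by move/eqP: E; rewrite eqseq_cat // eqxx andbT => /eqP/rcons_inj[].
Qed.

Lemma pos_in a b : suffix a b -> pos a - radius a < pos b /\ pos b < pos a + radius a.
Proof.
move=> /suffixP[s ->].
suff [] : pos a - radius a <= pos (s ++ a) - radius (s ++ a) /\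
  pos (s ++ a) + radius (s ++ a) <= pos a + radius a.
  by have := radius_gt0 (s ++ a); split; lra.
elim: s => [|d s [IH1 IH2]] /=; first by split.
by have := radius_gt0 (s ++ a); case: d; rewrite /offset; split; lra.
Qed.

Variant location (p b : address) : Prop :=
| LocOutL of ~~ suffix p b & pos b <= pos p - radius p
| LocOutR of ~~ suffix p b & pos p + radius p <= pos b
| LocSelf of b = p
| LocChild d of suffix (d :: p) b &
    pos p + offset d * radius p - radius p / 8 < pos b &
    pos b < pos p + offset d * radius p + radius p / 8.

Lemma locP p b : location p b.
Proof.
elim: p => [|d p IH].
  by case: (suffix_splitP (suffix0s b)) => [->|[d /[dup] sb /pos_in[/= ? ?]]];
    [exact: LocSelf|apply: (LocChild sb)].
have rp := radius_gt0 p.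
have [/suffix_splitP[->|[d' /[dup] sb /pos_in[/= ? ?]]]|nsb] := boolP (suffix (d :: p) b).
- exact: LocSelf.
- exact: (LocChild sb).
have [H|H] : pos b <= pos (d :: p) - radius (d :: p) \/ pos (d :: p) + radius (d :: p) <= pos b.
  case: IH => [_ ?|_ ?|->|d' sb H1 H2] /=.
  - by left; case: (d); rewrite /offset; lra.
  - by right; case: (d); rewrite /offset; lra.
  - by case: (d); rewrite /offset; [right|left|left]; lra.
  - have : d != d' by apply: contraNneq nsb => ->.
    by move: H1 H2; case: (d); case: (d') => //; rewrite /offset => *;
      first [left; lra | right; lra].
- exact: LocOutL.
- exact: LocOutR.
Qed.

Lemma pos_inj : injective pos.
Proof.
move=> a b E; have ra := radius_gt0 a.
case: (locP a b) => [_ H|_ H|->|d _ H1 H2] //; exfalso; [lra|lra|].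
by move: H1 H2; rewrite -E; case: d; rewrite /offset; lra.
Qed.

Lemma pos_out a b : ~~ suffix a b -> pos b <= pos a - radius a \/ pos a + radius a <= pos b.
Proof.
case: (locP a b) => [_ ?|_ ?|->|d sb _ _]; [by left|by right| |].
  by rewrite suffix_refl.
by rewrite (suffix_consl sb).
Qed.

(** * Levels of the vertices under a chord *)

Definition span2 (m n : nat) := [&& m != n, m <= n + 2 & n <= m + 2]%N.

Lemma mem_ends a e : e \in ends a ->
  [/\ e.2 = level e.1, suffix e.1 a & e.1 != a].
Proof.
elim: a e => [|d p IH] //= e.
have Hp x : x = (p, level p) -> [/\ x.2 = level x.1, suffix x.1 (d :: p) & x.1 != d :: p].
  by move=> ->; split => //; rewrite ?suffix_cons ?eqseq_cons //=; apply/eqP => /(congr1 size) /=; lia.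
have He x : x \in ends p -> [/\ x.2 = level x.1, suffix x.1 (d :: p) & x.1 != d :: p].
  move=> /IH[-> sx _]; split => //; first by apply: suffix_trans sx (suffix_cons _ _).
  by apply/eqP => E; move: sx; rewrite E suffix_cons_self.
move: He Hp; rewrite /ends /level /=.
by case: (kind_at p) => [|c i j|l r i]; case: d => /= He Hp; rewrite !inE;
  move=> /orP[/eqP->|/eqP->] || move=> /eqP->;
  try (by apply: Hp); apply: He; rewrite ?inE eqxx ?orbT.
Qed.

Lemma ends_out a e : e \in ends a ->
  pos e.1 <= pos a - radius a \/ pos a + radius a <= pos e.1.
Proof.
move=> /mem_ends[_ sx /eqP ne]; apply: pos_out.
by apply/negP => /(suffix_anti sx)/ne.
Qed.

Lemma ends_cons d p e : e \in ends (d :: p) -> e = (p, level p) \/ e \in ends p.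
Proof.
rewrite /ends /level /=; case: (kind_at p) => [|c i j|l r i]; case: d; rewrite /= !inE;
  do ?[case/orP]; move=> /eqP ->; rewrite ?eqxx ?orbT; by [left|right].
Qed.

(* The ends of an edge face occur around it in the cyclic order left end,
   face, right end; when both are on the same side, the far one is the lower. *)
Lemma edge_inv a l r i : kind_at a = Edge l r i ->
  span2 l.2 r.2 /\
  [\/ pos l.1 < pos a /\ pos a < pos r.1,
      [/\ pos a < pos r.1, pos r.1 < pos l.1 & (l.2 < r.2)%N] |
      [/\ pos r.1 < pos l.1, pos l.1 < pos a & (r.2 < l.2)%N]].
Proof.
elim: a l r i => [|d p IH] //= l r i.
have rp := radius_gt0 p.
have Ho := @ends_out p; move: IH Ho; rewrite /ends.
case: (kind_at p) => [|c i1 j1|l1 r1 i1]; case: d => //= IH Ho [<- <- _] /=;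
  rewrite /offset.
- by split; [rewrite /span2; lia|]; case: (Ho c); rewrite ?inE ?eqxx // => ?;
    [apply: Or31; lra|apply: Or32; split; [lra|lra|lia]].
- by split; [rewrite /span2; lia|]; case: (Ho c); rewrite ?inE ?eqxx // => ?;
    [apply: Or33; split; [lra|lra|lia]|apply: Or31; lra].
- have [sp H] := IH _ _ _ erefl.
  split; first by move: sp; rewrite /span2 /third; lia.
  case: (Ho l1); rewrite ?inE ?eqxx // => ?; first by apply: Or31; lra.
  apply: Or32; split; [lra|lra|].
  by move: sp; rewrite /span2 /third; case: H => [[]|[]|[]]; try lra; lia.
- have [sp H] := IH _ _ _ erefl.
  split; first by move: sp; rewrite /span2 /third; lia.
  case: (Ho r1); rewrite ?inE ?eqxx ?orbT // => ?; last by apply: Or31; lra.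
  apply: Or33; split; [lra|lra|].
  by move: sp; rewrite /span2 /third; case: H => [[]|[]|[]]; try lra; lia.
Qed.

(** A vertex stacked on a face with an end lies above the lowest end, and the new faces have as ends
    only this vertex and old ends. So the bound passes to all descendants. *)
Lemma level_floor a b m : suffix a b -> ends a != [::] ->
  all (fun e => m <= e.2)%N (ends a) -> (m < level b)%N.
Proof.
move=> /suffixP[s ->] ne H.
suff [_ _] : [/\ ends (s ++ a) != [::], all (fun e => m <= e.2)%N (ends (s ++ a)) &
   (m < level (s ++ a))%N] by [].
have Ht p : ends p != [::] -> all (fun e => m <= e.2)%N (ends p) -> (m < level p)%N.
  rewrite /ends /level; case E: (kind_at p) => [|c i j|l r i] //= _; first by lia.
  by have [+ _] := edge_inv E; rewrite /span2 /third; lia.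
elim: s => [|d s [IH1 IH2 IH3]] /=; first by split => //; apply: Ht.
have [E1 E2] : ends (d :: s ++ a) != [::] /\ all (fun e => m <= e.2)%N (ends (d :: s ++ a)).
  move: IH1 IH2 IH3; rewrite /ends /level /=.
  by case: (kind_at (s ++ a)) => [|c i j|l r i]; case: d => //=; lia.
by split => //; apply: Ht.
Qed.

Definition between (x y z : rat) := (x < y /\ y < z) \/ (z < y /\ y < x).

(** Induction on the address [d :: p]. If [e] is [p], then [b] lies in the [DM] branch, whose only
    end is [p]. Otherwise [b] is outside the subtree of [p], where the chord from [e] to [p] serves,
    or inside it, and then [e] is the lowest end of [p]. *)
Lemma between_level a e b : e \in ends a -> ~~ suffix a b ->
  between (pos e.1) (pos b) (pos a) -> (e.2 < level b)%N.
Proof.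
elim: a e b => [|d p IH] //= e b ea nsb bt.
have rp := radius_gt0 p.
have [Ee|ep] := ends_cons ea.
  subst e; move: bt => /=.
  case: (locP p b) => [_ H|_ H|->|d' sb H1 H2].
  + by rewrite /between; case: (d); rewrite /offset; lra.
  + by rewrite /between; case: (d); rewrite /offset; lra.
  + by rewrite /between; lra.
  have dd' : d != d' by apply: contraNneq nsb => ->.
  have [sl _|] := eqVneq (ends (d' :: p)) [:: (p, level p)].
    by apply: level_floor sb _ _; rewrite sl //= leqnn.
  move: H1 H2; rewrite /ends /between /level /=.
  case: (kind_at p) => [|c i j|l r i]; case: (d') dd'; case: (d) => //= _;
    rewrite ?eqxx // /offset => H1 H2 _; lra.
have inside : (e.2 <= head 0 (map snd (ends p)))%N -> (e.2 <= last 0 (map snd (ends p)))%N ->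
   suffix p b -> (e.2 < level b)%N.
  move=> m1 m2 sb; apply: level_floor sb _ _; first by case: (ends p) ep.
  move: m1 m2; rewrite /ends; case: (kind_at p) => [|c i j|l r i] //=; lia.
have eo := ends_out ep.
have [sb|np] := boolP (suffix p b); last first.
  apply: (IH e b ep np); move: bt (pos_out np); rewrite /between.
  by case: (d); rewrite /offset; lra.
have Hb : (match d with DL => pos p <= pos b | DM => true
           | DR => pos b <= pos p + radius p / 2 end : bool).
  case: (locP p b) => [|||d' sb' H1 H2]; rewrite ?sb //.
    by move=> ->; case: (d); lra.
  have dd' : d != d' by apply: contraNneq nsb => ->.
  by move: H1 H2; case: (d') dd'; case: (d) => //= _; rewrite /offset; lra.
have [_ _ nep] := mem_ends ep.
move: ea ep inside eo bt Hb; rewrite /ends /=.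
case E: (kind_at p) => [|c i j|l r i]; first by case: (d).
  by rewrite /= !inE => _ /eqP-> inside *; apply: inside.
have [sp ord] := edge_inv E.
have ll : (r.2 < l.2)%N -> pos l.1 < pos p.
  by case: ord => [[]|[? ? ?]|[? ? ?]] *; [lra|lia|lra].
have rr : (l.2 < r.2)%N -> pos p < pos r.1.
  by case: ord => [[]|[? ? ?]|[? ? ?]] *; [lra|lra|lia].
have nlr : l.2 != r.2 by case/and3P: sp.
have {}nep (x : nat) : e == (p, x) -> False by case/eqP=> ?; subst e; rewrite eqxx in nep.
case: (d) => /=; rewrite !inE /between /offset.
- case/orP=> [/eqP->|/nep //] _ /= inside eo bt Hb.
  have [lr|] := ltnP l.2 r.2; first by apply: inside => //; apply: ltnW.
  by rewrite leq_eqVlt eq_sym (negPf nlr) /= => /ll; lra.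
- by move=> /nep.
- case/orP=> [/nep //|/eqP->] _ /= inside eo bt Hb.
  have [rl|] := ltnP r.2 l.2; first by apply: inside => //; apply: ltnW.
  by rewrite leq_eqVlt (negPf nlr) /= => /rr; lra.
Qed.

(** It remains to treat descendants of [a]. The child face holding [b] has as ends [a] and at most
    one end of [a]; if that one is not [e], then [e] is the far end, which is the lower one by
    [edge_inv]. *)
Lemma between_min a e b : e \in ends a -> b != a ->
  between (pos e.1) (pos b) (pos a) -> (minn e.2 (level a) < level b)%N.
Proof.
move=> ea /eqP ba bt; have [sb|nsb] := boolP (suffix a b); last first.
  by have := between_level ea nsb bt; lia.
have ra := radius_gt0 a.
have eo := ends_out ea.
case: (locP a b) => [|||d sbd H1 H2]; rewrite ?sb // {ba}.
apply: level_floor sbd _ _; move: ea H1 H2; rewrite /ends /level /=.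
  by case: (kind_at a) => [|c i j|l r i]; case: (d).
case E: (kind_at a) => [|c i j|l r i] //=; rewrite !inE.
  by move=> /eqP->; case: (d) => /= _ _; rewrite ?geq_minl ?geq_minr.
have [sp ord] := edge_inv E.
have ll : pos a < pos l.1 -> (l.2 < r.2)%N.
  by case: ord => [[? ?]|[? ? ->]|[? ? ?]] *; rewrite ?leqnn //; exfalso; lra.
have rr : pos r.1 < pos a -> (r.2 < l.2)%N.
  by case: ord => [[? ?]|[? ? ?]|[? ? ->]] *; rewrite ?leqnn //; exfalso; lra.
move: bt; rewrite /between /offset.
case: (d) => /= bt /orP[] /eqP Ee H1 H2; rewrite Ee in eo bt *; rewrite ?geq_minl ?geq_minr //=.
- have /ltnW rl : (r.2 < l.2)%N by apply: rr; lra.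
  by rewrite geq_min rl.
- have /ltnW lr : (l.2 < r.2)%N by apply: ll; lra.
  by rewrite geq_min lr.
Qed.

(** * Chords of a component do not cross *)

Definition outside (s p q : rat) := (s < p /\ s < q) \/ (p < s /\ q < s).
Definition nocross p q r s :=
  ~ (between p r q /\ outside s p q) /\ ~ (between p s q /\ outside r p q).

Lemma mem_ends_suffix a b e : suffix a b -> e \in ends b ->
  suffix a e.1 \/ e \in ends a.
Proof.
move=> /suffixP[s ->]; elim: s => [|d s IH] /=; first by right.
have Hs : suffix a (s ++ a) by rewrite suffix_suffix.
move: IH; rewrite /ends /=; case: (kind_at (s ++ a)) => [|c i j|l r i]; case: d => IH /=; rewrite !inE;
  do ?[case/orP]; move=> /eqP E; rewrite E /=; first [by left | by rewrite -E; apply: IH; rewrite E !inE eqxx ?orbT].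
Qed.

Lemma nocross_sym p q r s : nocross p q r s -> nocross r s p q.
Proof. by rewrite /nocross /between /outside; case=> H1 H2; split=> -[H3 H4]; lra. Qed.

Lemma nocross_swapl p q r s : nocross p q r s -> nocross q p r s.
Proof. by rewrite /nocross /between /outside; case=> H1 H2; split=> -[H3 H4]; lra. Qed.

Lemma nocross_swapr p q r s : nocross p q r s -> nocross p q s r.
Proof. by rewrite /nocross; tauto. Qed.

Lemma nocross_share p q s : nocross p q p s.
Proof. by rewrite /nocross /between /outside; split=> -[H3 H4]; lra. Qed.

Lemma nocross_gap p q r s : ~ between p r q -> ~ between p s q -> nocross p q r s.
Proof. by rewrite /nocross; tauto. Qed.

(** Neither [l] nor [r] lies in [[a, b]], so the cyclic order is [l], [a], [b], [r], and each chord
    joins consecutive points. *)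
Lemma nocross_cyclic l a p b r :
  (l < p /\ p < r) \/ (p < r /\ r < l) \/ (r < l /\ l < p) ->
  a <= p -> p <= b -> l < a \/ b < l -> r < a \/ b < r -> nocross l a r b.
Proof.
rewrite /nocross /between /outside => ord ap pb Hl Hr.
by split=> -[H3 H4]; lra.
Qed.

(** Seen from outside the interval of radius [d] around [p], the points [a] and [p] hold the same
    place. *)
Lemma nocross_move p d a z x y : p - d < a -> a < p + d ->
  z <= p - d \/ p + d <= z -> x <= p - d \/ p + d <= x -> y <= p - d \/ p + d <= y ->
  nocross z p x y -> nocross z a x y.
Proof.
move=> pa ap Hz Hx Hy.
have bt w : w <= p - d \/ p + d <= w -> between z w a -> between z w p.
  by rewrite /between; lra.
have ou w : w <= p - d \/ p + d <= w -> outside w z a -> outside w z p.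
  by rewrite /outside; lra.
have := bt _ Hx; have := bt _ Hy; have := ou _ Hx; have := ou _ Hy.
by clear; rewrite /nocross; tauto.
Qed.

Lemma ends_child d p e : e \in ends (d :: p) -> e = (p, level p) \/
  d != DM /\ match kind_at p with
             | Root => False
             | Slot c _ _ => e = c
             | Edge l r _ => d = DL /\ e = l \/ d = DR /\ e = r
             end.
Proof.
rewrite /ends /level /=; case: (kind_at p) => [|c i j|l r i]; case: d; rewrite /= !inE;
  do ?[case/orP]; move=> /eqP ->; by [left|right; auto].
Qed.

(** Induction on the address [d :: p]. If [b] is outside the subtree of [p], the chord stays in the
    interval of [p] or can be moved to [p]. If [b] is below another child, the two branches share
    only [p] and its ends, whose cyclic order is known. *)
Lemma chords_nocross a e b e' : e \in ends a -> e' \in ends b ->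
  ~~ suffix a b -> nocross (pos e.1) (pos a) (pos e'.1) (pos b).
Proof.
elim: a e => [|d p IH] // e ea eb nsb.
have rp := radius_gt0 p.
have [_ se' _] := mem_ends eb.
have [pa ap] := pos_in (suffix_cons p d).
have [sb|np] := boolP (suffix p b); last first.
  have np' : ~~ suffix p e'.1 by apply: contra np => /suffix_trans; apply.
  have [ob oe'] := (pos_out np, pos_out np').
  have [Ee|ep] := ends_cons ea.
    rewrite Ee [(p, _).1]/=; apply: nocross_gap; rewrite /between; clear -rp pa ap ob oe'; lra.
  exact: nocross_move pa ap (ends_out ep) oe' ob (IH _ ep eb np).
have out x : x \in ends p -> pos x.1 <= pos p - radius p \/ pos p + radius p <= pos x.1.
  exact: ends_out.
have ord l r i : kind_at p = Edge l r i ->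
  [/\ pos l.1 <= pos p - radius p \/ pos p + radius p <= pos l.1,
      pos r.1 <= pos p - radius p \/ pos p + radius p <= pos r.1 &
      (pos l.1 < pos p /\ pos p < pos r.1) \/
      (pos p < pos r.1 /\ pos r.1 < pos l.1) \/ (pos r.1 < pos l.1 /\ pos l.1 < pos p)].
  move=> E; split; try by apply: out; rewrite /ends E !inE eqxx ?orbT.
  by case: (edge_inv E) => _ [|[? ? _]|[? ? _]]; [left|right; left|right; right].
case: (locP p b) => [|||d' sbd H1 H2]; rewrite ?sb //.
  move=> bp; rewrite {}bp {nsb sb se'} in eb *.
  have [->|[_]] := ends_child ea; first exact/nocross_swapr/nocross_share.
  move: eb; rewrite {1}/ends; case E: (kind_at p) => [|c i j|l r i] //; rewrite !inE.
    by move=> /eqP-> ->; apply: nocross_share.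
  have [ol or cyc] := ord _ _ _ E; clear -rp ol or cyc.
  case/orP=> /eqP-> [[-> ->]|[-> ->]]; try exact: nocross_share.
  - by apply/nocross_sym/(nocross_cyclic cyc) => /=; lra.
  - by apply: (nocross_cyclic cyc) => /=; lra.
have dd' : d != d' by apply: contraNneq nsb => ->.
have [se'd|e'c] := mem_ends_suffix sbd eb.
  have nse : ~~ suffix (d' :: p) e.1.
    have se : (size e.1 <= size p)%N.
      by case: (ends_cons ea) => [->//|/mem_ends[_ /size_suffix]].
    by apply/negP => /size_suffix /=; rewrite ltnNge se.
  have nsa : ~~ suffix (d' :: p) (d :: p).
    apply: contraNN dd' => sd; rewrite eq_sym; apply/eqP.
    exact: suffix_cons_inj sd (suffix_refl _).
  have [q1 q2] := pos_in sbd; have [q3 q4] := pos_in se'd.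
  have [o1 o2] := (pos_out nse, pos_out nsa).
  by apply/nocross_sym/nocross_gap; rewrite /between; clear -q1 q2 q3 q4 o1 o2; lra.
have [Ee|[dM He]] := ends_child ea; have [Ee'|[d'M He']] := ends_child e'c.
- by rewrite Ee Ee'; apply: nocross_share.
- have oe' : pos e'.1 <= pos p - radius p \/ pos p + radius p <= pos e'.1.
    by apply: out; move: He'; rewrite /ends; case: (kind_at p) => // [c i j ->|l r i [[_ ->]|[_ ->]]];
      rewrite !inE eqxx ?orbT.
  rewrite Ee; apply: nocross_gap; rewrite /between [(_, _).1]/=.
    by clear -rp pa ap oe'; lra.
  clear -rp H1 H2 dd' d'M; move: H1 H2; case: d' dd' d'M => //; case: d => //= _ _; lra.
- have oe : pos e.1 <= pos p - radius p \/ pos p + radius p <= pos e.1.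
    by apply: out; move: He; rewrite /ends; case: (kind_at p) => // [c i j ->|l r i [[_ ->]|[_ ->]]];
      rewrite !inE eqxx ?orbT.
  have [q1 q2] := pos_in sb.
  rewrite Ee'; apply/nocross_sym/nocross_gap; rewrite /between [(_, _).1]/=.
    by clear -rp oe q1 q2; lra.
  clear -rp H1 H2 dd' dM; move: H1 H2; case: d dd' dM => //; case: d' => //= _ _; lra.
move: He He'; case E: (kind_at p) => [|c i j|l r i] //.
  by move=> -> ->; apply: nocross_share.
have [ol or cyc] := ord _ _ _ E; clear -rp ol or cyc H1 H2 dd'.
move=> [[dE ->]|[dE ->]] [[dE' ->]|[dE' ->]]; subst d d';
  move: H1 H2 dd'; rewrite ?eqxx //= => H1 H2 _.
- by apply: (nocross_cyclic cyc) => /=; lra.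
- by apply/nocross_sym/(nocross_cyclic cyc) => /=; lra.
Qed.

Definition end_addrs a : seq address := map fst (ends a).
Definition adjO a b := (a \in end_addrs b) || (b \in end_addrs a).

Lemma adjO_sym a b : adjO a b = adjO b a.
Proof. by rewrite /adjO orbC. Qed.

Lemma end_addrsP a b : reflect ((b, level b) \in ends a) (b \in end_addrs a).
Proof.
apply: (iffP mapP) => [[[x t] xe -> /=]|]; last by exists (b, level b).
by have [/= <- _ _] := mem_ends xe.
Qed.

Lemma adjO_span a b : adjO a b -> span2 (level a) (level b).
Proof.
wlog : a b / b \in end_addrs a => [H|/end_addrsP].
  case/orP => [|ab]; last by apply: H => //; rewrite /adjO ab orbT.
  by move=> ba; have := H b a ba; rewrite /adjO ba orbT => /(_ isT); rewrite /span2; lia.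
have ta : level a = level_of (kind_at a) by [].
move=> + _; rewrite /ends /span2; move: ta.
case E: (kind_at a) => [|c i j|l r i] //= ->; rewrite !inE.
  by move=> /eqP <- /=; lia.
have [sp _] := edge_inv E; move: sp; rewrite /span2 /third => sp.
by case/orP => /eqP El; rewrite -El /= in sp *; lia.
Qed.

Lemma adjO_nocross u v x y : adjO u v -> adjO x y ->
  nocross (pos u) (pos v) (pos x) (pos y).
Proof.
have main a b c d : b \in end_addrs a -> d \in end_addrs c -> nocross (pos b) (pos a) (pos d) (pos c).
  move=> /end_addrsP ab /end_addrsP cd.
  have [ac|ac] := boolP (suffix a c); last exact: (chords_nocross ab cd ac).
  have [ca|ca] := boolP (suffix c a); last exact/nocross_sym/(chords_nocross cd ab ca).
  rewrite (suffix_anti ac ca).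
  by rewrite /nocross /between /outside; split=> -[H3 H4]; lra.
case/orP=> uv /orP[] xy.
- exact: main.
- exact/nocross_swapr/main.
- exact/nocross_swapl/main.
- exact/nocross_swapl/nocross_swapr/main.
Qed.

Lemma adjO_between u v w : adjO u v -> w != u -> w != v ->
  between (pos u) (pos w) (pos v) -> (minn (level u) (level v) < level w)%N.
Proof.
case/orP=> /end_addrsP uv wu wv bt; first exact: (between_min uv).
by rewrite minnC; apply: (between_min uv) => //; move: bt; rewrite /between /=; lra.
Qed.

(** Let [u] and [x] be the lower ends. By [adjO_between], [x] is not between [u] and [v], nor [u]
    between [x] and [y]. So [pos y < pos v] would force the order [u], [y], [v], [x], where the
    chords cross. *)
Lemma adjO_noX u v x y : adjO u v -> adjO x y -> level u = level x -> level v = level y ->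
  pos u < pos x -> pos v <= pos y.
Proof.
wlog lt_uv : u v x y / (level u < level v)%N => [H|] uv xy ux vy.
  have [||E] := ltngtP (level u) (level v); first by move/H; apply.
    move=> lt lux; rewrite leNgt; apply/negP => lyv.
    have : pos x <= pos u.
      by apply: (H y x v u) => //; rewrite ?(adjO_sym y) ?(adjO_sym v) -?vy -?ux.
    lra.
  by have := adjO_span uv; rewrite E /span2 eqxx.
move=> lux; rewrite leNgt; apply/negP => lyv.
have nc := adjO_nocross uv xy.
have H1 : ~ between (pos u) (pos x) (pos v).
  move=> bt; have := adjO_between uv _ _ bt.
  have -> : x != u by apply/eqP => E; rewrite E ltxx in lux.
  have -> : x != v by apply/eqP => E; rewrite -E -ux ltnn in lt_uv.
  by move=> /(_ isT isT); lia.
have H2 : ~ between (pos x) (pos u) (pos y).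
  move=> bt; have := adjO_between xy _ _ bt.
  have -> : u != x by apply/eqP => E; rewrite E ltxx in lux.
  have -> : u != y by apply/eqP => E; rewrite E -vy ltnn in lt_uv.
  by move=> /(_ isT isT); lia.
have nvx : pos v != pos x by apply/eqP => /pos_inj E; rewrite E -ux ltnn in lt_uv.
have nuy : pos u != pos y by apply/eqP => /pos_inj E; rewrite E -vy ltnn in lt_uv.
move: nvx nuy; rewrite !neq_lt; case: nc => n1 n2 {ux vy lt_uv uv xy}.
by move: n1 n2 H1 H2; rewrite /between /outside => n1 n2 H1 H2 /orP[] ? /orP[] ?; lra.
Qed.

(** * Linear order on the triangles of a component *)

Definition isEdge a := if kind_at a is Edge _ _ _ then true else false.
Definition triangle_at a : seq address := if kind_at a is Edge l r _ then [:: l.1; a; r.1] else [::].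
Definition base_level a : nat := if kind_at a is Edge l r _ then minn l.2 r.2 else 0%N.
(** Three consecutive levels starting at [2w] or [2w + 1] lie among [2w, ..., 2w + 3] and contain
    both middle levels. *)
Definition window a : nat := (base_level a %/ 2)%N.

(* A triangle has at most one vertex on each level, so the sum has at most one
   term. *)
Definition pos_at_level a n := \sum_(x <- triangle_at a | level x == n) pos x.
(** To be compared lexicographically. The vertex off the middle levels is on only one of the two
    outer levels; the other contributes 0 to the sum. *)
Definition rank a : seq rat :=
  [:: (window a)%:R; pos_at_level a (window a).*2.+1; pos_at_level a (window a).*2.+2;
      pos_at_level a (window a).*2 + pos_at_level a (window a).*2.+3].

Lemma edge_adj a l r i : kind_at a = Edge l r i -> adjO l.1 r.1.
Proof.
case: a => [|d p] //=; rewrite /adjO /end_addrs /ends.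
by case E: (kind_at p) => [|c i1 j|l1 r1 i1]; case: d => //= -[<- <- _] /=;
  rewrite E /= ?inE eqxx ?orbT.
Qed.

Lemma adj_triangle a u v : u \in triangle_at a -> v \in triangle_at a -> u != v -> adjO u v.
Proof.
rewrite /triangle_at; case E: (kind_at a) => [|c i j|l r i] //.
have lr := edge_adj E.
have la : adjO l.1 a by rewrite /adjO /end_addrs /ends E /= inE eqxx.
have ra : adjO a r.1 by rewrite /adjO /end_addrs /ends E /= !inE eqxx !orbT.
rewrite !inE => /or3P[] /eqP-> /or3P[] /eqP->; rewrite ?eqxx // => _;
  by rewrite ?lr ?la ?ra // adjO_sym ?lr ?la ?ra.
Qed.

Lemma triangleP a : isEdge a -> exists x y z,
  [/\ perm_eq (triangle_at a) [:: x; y; z], level x = base_level a, level y = (base_level a).+1 & level z = (base_level a).+2].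
Proof.
have ta : level a = level_of (kind_at a) by [].
have Hm e : e \in ends a -> level e.1 = e.2 by case/mem_ends.
move: Hm ta; rewrite /isEdge /triangle_at /base_level /ends.
case E: (kind_at a) => [|c i j|l r i] //= Hm ta _.
have tl : level l.1 = l.2 by apply: Hm; rewrite inE eqxx.
have tr : level r.1 = r.2 by apply: Hm; rewrite !inE eqxx orbT.
have [] := edge_inv E; rewrite -tl -tr /span2 => sp _.
have P3 (x y z x' y' z' : address) : (forall f : pred address, f x + f y + f z = f x' + f y' + f z')%N ->
    perm_eq [:: x; y; z] [:: x'; y'; z'].
  by move=> H; apply/seq.permP => f /=; have := H f; lia.
have [D|[D|[D|D]]] : level r.1 = (level l.1).+1 \/ level r.1 = (level l.1).+2 \/
    level l.1 = (level r.1).+1 \/ level l.1 = (level r.1).+2 by lia.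
- exists l.1, r.1, a; split; rewrite ?ta -?tl -?tr ?D /third; try lia.
  by apply: P3 => f; lia.
- exists l.1, a, r.1; split; rewrite ?ta -?tl -?tr ?D /third; try lia.
  by apply: P3 => f; lia.
- exists r.1, l.1, a; split; rewrite ?ta -?tl -?tr ?D /third; try lia.
  by apply: P3 => f; lia.
- exists r.1, a, l.1; split; rewrite ?ta -?tl -?tr ?D /third; try lia.
  by apply: P3 => f; lia.
Qed.

Lemma rankP a : isEdge a -> exists x y z,
  [/\ perm_eq (triangle_at a) [:: x; y; z], level x = (window a).*2.+1, level y = (window a).*2.+2,
      level z = (window a).*2 \/ level z = (window a).*2.+3 &
      rank a = [:: (window a)%:R; pos x; pos y; pos z]].
Proof.
case/triangleP=> x [y [z [P tx ty tz]]].
have P3 (x' y' z' : address) : (forall f : pred address, f x + f y + f z = f x' + f y' + f z')%N ->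
    perm_eq (triangle_at a) [:: x'; y'; z'].
  by move=> H; apply: (perm_trans P); apply/seq.permP => f /=; have := H f; lia.
have R p q r : perm_eq (triangle_at a) [:: p; q; r] -> level p = (window a).*2.+1 -> level q = (window a).*2.+2 ->
  level r = (window a).*2 \/ level r = (window a).*2.+3 -> exists x y z,
  [/\ perm_eq (triangle_at a) [:: x; y; z], level x = (window a).*2.+1, level y = (window a).*2.+2,
      level z = (window a).*2 \/ level z = (window a).*2.+3 &
      rank a = [:: (window a)%:R; pos x; pos y; pos z]].
  move=> P' tp tq tr; exists p, q, r; split => //.
  rewrite /rank /pos_at_level !(perm_big _ P') /= !big_cons !big_nil tp tq.
  move: (window a).*2 tr => w tr.
  have E m n : (w + m == w + n)%N = (m == n) by rewrite eqn_add2l.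
  have E0 m : (w + m == w)%N = (m == 0)%N by rewrite -{2}[w]addn0 eqn_add2l.
  rewrite -[w.+3]addn3 -[w.+2]addn2 -[w.+1]addn1.
  have [-> | ->] : level r = (w + 0)%N \/ level r = (w + 3)%N by lia.
    by rewrite !E !E0 /= !addr0 ?add0r.
  by rewrite !E !E0 /= !addr0 ?add0r.
have [D|D] : base_level a = (window a).*2 \/ base_level a = (window a).*2.+1 by rewrite /window; lia.
- by apply: (R y z x); [apply: P3 => f|..]; rewrite ?tx ?ty ?tz ?D; try lia; left.
- by apply: (R x y z); [apply: P3 => f|..]; rewrite ?tx ?ty ?tz ?D; try lia; right.
Qed.

(** The rank determines the vertices of the triangle, and its own address is the one that has all of
    them as suffixes. *)
Lemma rank_inj a b : isEdge a -> isEdge b -> rank a = rank b -> a = b.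
Proof.
move=> /[dup] ea /rankP[x [y [z [P _ _ _ ->]]]] /[dup] eb /rankP[x' [y' [z' [P' _ _ _ ->]]]].
case=> _ /pos_inj xx /pos_inj yy /pos_inj zz; subst x' y' z'.
have sub c d : isEdge d -> c \in triangle_at d -> suffix c d.
  have := @mem_ends d; rewrite /triangle_at /isEdge /ends; case: (kind_at d) => // l r i H _.
  rewrite !inE => /or3P[] /eqP->; last 1 first.
  - by have [] := H r; rewrite ?inE ?eqxx ?orbT.
  - by have [] := H l; rewrite ?inE ?eqxx ?orbT.
  by rewrite suffix_refl.
have self d : isEdge d -> d \in triangle_at d.
  by rewrite /triangle_at /isEdge; case: (kind_at d) => // l r i _; rewrite !inE eqxx orbT.
apply: suffix_anti; apply: sub => //.
  by rewrite (perm_mem P') -(perm_mem P) self.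
by rewrite (perm_mem P) -(perm_mem P') self.
Qed.

Definition key := seqlexi rat.

Lemma ltkey_cons x y (s t : seq rat) :
  (x :: s < y :: t :> key)%O = (x < y) || (x == y) && (s < t :> key)%O.
Proof.
by rewrite [LHS]ltxi_cons; case: (ltgtP x y).
Qed.

(* The window determines the parity class, and windows of the same class are
   on disjoint sets of levels; inside one window every triangle has exactly one
   edge between the two middle levels, and these edges are linearly ordered. *)
Lemma rank_lt_mono a b u v : isEdge a -> isEdge b -> odd (window a) = odd (window b) ->
  u \in triangle_at a -> v \in triangle_at b -> level u = level v %[mod 5] ->
  (rank a < rank b :> seqlexi rat)%O ->
  (level u < level v)%N \/ level u = level v /\ pos u <= pos v.
Proof.
move=> /rankP[x [y [z [P tx ty tz ->]]]] /rankP[x' [y' [z' [P' tx' ty' tz' ->]]]] ow ua vb uv.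
have adj s t : s \in [:: x; y; z] -> t \in [:: x; y; z] -> level s != level t -> adjO s t.
  rewrite -!(perm_mem P) => sa ta nst; apply: adj_triangle sa ta _.
  by apply: contraNneq nst => ->.
have adj' s t : s \in [:: x'; y'; z'] -> t \in [:: x'; y'; z'] -> level s != level t -> adjO s t.
  rewrite -!(perm_mem P') => sa ta nst; apply: adj_triangle sa ta _.
  by apply: contraNneq nst => ->.
have rng p : p \in [:: x; y; z] -> ((window a).*2 <= level p <= (window a).*2 + 3)%N.
  by rewrite !inE => /or3P[] /eqP->; lia.
have rng' p : p \in [:: x'; y'; z'] -> ((window b).*2 <= level p <= (window b).*2 + 3)%N.
  by rewrite !inE => /or3P[] /eqP->; lia.
rewrite (perm_mem P) in ua; rewrite (perm_mem P') in vb.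
have := rng _ ua; have := rng' _ vb => rv ru.
(* Distinct windows of equal parity differ by at least 2, so their blocks of four levels are
   disjoint. Within one block, levels equal modulo 5 are equal. *)
rewrite !ltkey_cons ltr_nat eqr_nat => /orP[lt_w|/andP[/eqP Ew lex]]; first by left; lia.
have Euv : level u = level v by clear -ru rv uv Ew; lia.
have inx : x \in [:: x; y; z] by rewrite inE eqxx.
have iny : y \in [:: x; y; z] by rewrite !inE eqxx orbT.
have inz : z \in [:: x; y; z] by rewrite !inE eqxx !orbT.
have inx' : x' \in [:: x'; y'; z'] by rewrite inE eqxx.
have iny' : y' \in [:: x'; y'; z'] by rewrite !inE eqxx orbT.
have inz' : z' \in [:: x'; y'; z'] by rewrite !inE eqxx !orbT.
rewrite -{}Ew in tx' ty' tz'; move: (window a).*2 tx ty tz tx' ty' tz' => w tx ty tz tx' ty' tz'.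
have [nzx nzy nzx' nzy'] : [/\ level z != w.+1, level z != w.+2, level z' != w.+1 & level z' != w.+2].
  by clear -tz tz'; case: tz => ->; case: tz' => ->; split; lia.
right; split => //.
have {ua vb rng rng' ru rv uv ow} [[? ?]|[[? ?]|[? ?]]] :
    (u = x /\ v = x') \/ (u = y /\ v = y') \/ (u = z /\ v = z').
  clear adj adj'; move: ua vb Euv; rewrite !inE => /or3P[] /eqP-> /or3P[] /eqP->;
    rewrite ?tx ?ty ?tx' ?ty'; try (by auto); move=> E; exfalso.
  - by clear -E; lia.
  - by rewrite -E eqxx in nzx'.
  - by clear -E; lia.
  - by rewrite -E eqxx in nzy'.
  - by rewrite E eqxx in nzx.
  - by rewrite E eqxx in nzy.
- subst u v; case/orP: lex => [/ltW //|/andP[/eqP-> _]]; exact: lexx.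
- subst u v; case/orP: lex => [lt|/andP[_ /orP[/ltW //|/andP[/eqP-> _]]]]; last exact: lexx.
  apply: (adjO_noX _ _ _ _ lt) => //; [apply: adj|apply: adj'|]; rewrite ?tx ?ty ?tx' ?ty' //;
    by clear; lia.
(* The outer vertices follow the first middle vertices that differ, by [adjO_noX] on the edges
   joining them. *)
- subst u v; case/orP: lex => [lt|/andP[_ /orP[lt|/andP[_ /orP[/ltW //|/andP[/eqP-> _]]]]]]; last exact: lexx.
  + by apply: (adjO_noX _ _ _ _ lt) => //; [apply: adj|apply: adj'|]; rewrite ?tx ?tx' // eq_sym.
  + by apply: (adjO_noX _ _ _ _ lt) => //; [apply: adj|apply: adj'|]; rewrite ?ty ?ty' // eq_sym.
Qed.

(** * The universal planar 3-tree *)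

(* The successive triangles, nearest first, to which a component and its
   ancestors are attached; the boolean tells apart the two sides of the base_level
   triangle. *)
Definition comp_path := seq (address * bool).
Definition uvertex := (comp_path * address)%type.

Fixpoint palette (g : comp_path) : nat :=
  if g is b :: g' then ((palette g' + 1 + odd (window b.1)) %% 5)%N else 0%N.

Fixpoint comp_key (g : comp_path) : seq rat :=
  if g is b :: g' then comp_key g' ++ rcons (rank b.1) (b.2 : nat)%:R else [::].

(** Vertices of equal depth have component keys of equal length, so keys compare block by block. The
    level precedes the position because one track holds a whole residue class of levels. *)
Definition vertex_key (x : uvertex) : key :=
  (size x.1)%:R :: comp_key x.1 ++ [:: (level x.2)%:R; pos x.2].

Definition track_of (x : uvertex) : nat := (palette x.1 * 5 + level x.2 %% 5)%N.

Definition valid (x : uvertex) := all (fun b => isEdge b.1) x.1.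

Lemma palette_lt5 g : (palette g < 5)%N.
Proof. by case: g => //= b g; rewrite ltn_pmod. Qed.

Lemma track_of_lt25 x : (track_of x < 25)%N.
Proof. by rewrite /track_of; have := palette_lt5 x.1; have := ltn_pmod (level x.2) (isT : 0 < 5)%N; lia. Qed.

Lemma track_of_eq x y : track_of x = track_of y -> palette x.1 = palette y.1 /\ level x.2 = level y.2 %[mod 5].
Proof.
rewrite /track_of; have := palette_lt5 x.1; have := palette_lt5 y.1.
by have := ltn_pmod (level x.2) (isT : 0 < 5)%N; have := ltn_pmod (level y.2) (isT : 0 < 5)%N; lia.
Qed.

Lemma size_comp_key g : size (comp_key g) = (5 * size g)%N.
Proof. by elim: g => //= b g IH; rewrite size_cat IH /=; lia. Qed.

Lemma ltkey_cat (s t a b : seq rat) : size s = size t ->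
  (s ++ a < t ++ b :> key)%O = (s < t :> key)%O || (s == t) && (a < b :> key)%O.
Proof.
elim: s t => [|x s IH] [|y t] //= [st]; rewrite !ltkey_cons (IH _ st) eqseq_cons.
by case: (ltgtP x y).
Qed.

Lemma comp_key_inj g h : all (fun b => isEdge b.1) g -> all (fun b => isEdge b.1) h ->
  size g = size h -> comp_key g = comp_key h -> g = h.
Proof.
elim: g h => [|[b s] g IH] [|[c t] h] //= /andP[eb vg] /andP[ec vh] [gh] /eqP.
rewrite eqseq_cat ?size_comp_key ?gh // => /andP[/eqP /(IH _ vg vh gh) <-].
rewrite -[X in X == _]/(rcons (rank b) s%:R) -[X in _ == X]/(rcons (rank c) t%:R).
rewrite eqseq_rcons => /andP[/eqP/(rank_inj eb ec) <-].
by rewrite eqr_nat; case: s; case: t.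
Qed.

Lemma vertex_key_inj x y : valid x -> valid y -> vertex_key x = vertex_key y -> x = y.
Proof.
case: x y => [g a] [h b] vg vh; rewrite /vertex_key /= => -[/eqP]; rewrite eqr_nat => /eqP gh /eqP.
rewrite eqseq_cat ?size_comp_key ?gh // => /andP[/eqP /(comp_key_inj vg vh gh) /= -> /eqP[_ /pos_inj ->]].
by [].
Qed.

Lemma vertex_key_lt x y : (vertex_key x < vertex_key y)%O ->
  [\/ (size x.1 < size y.1)%N,
      size x.1 = size y.1 /\ (comp_key x.1 < comp_key y.1 :> key)%O |
      [/\ size x.1 = size y.1, comp_key x.1 = comp_key y.1 &
          (level x.2 < level y.2)%N \/ level x.2 = level y.2 /\ pos x.2 < pos y.2]].
Proof.
rewrite /vertex_key ltkey_cons ltr_nat eqr_nat => /orP[|/andP[/eqP gh]]; first by constructor 1.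
rewrite ltkey_cat ?size_comp_key ?gh // => /orP[|/andP[/eqP E]]; first by constructor 2.
rewrite !ltkey_cons ltr_nat eqr_nat => H; constructor 3; split => //.
by case/orP: H => [->|/andP[/eqP ->]]; [left|rewrite andbF orbF; right].
Qed.

(** * Edges of the universal graph and absence of X-crossings *)

Definition in_comp (u v : uvertex) := v.1 = u.1 /\ adjO u.2 v.2.
Definition parent_of (u v : uvertex) := exists2 b, v.1 = b :: u.1 & u.2 \in triangle_at b.1.

(** Keys separate distinct components. Within one, edges span at most two levels, so congruence
    modulo 5 and opposite orders force equal levels, and [adjO_noX] applies. *)
Lemma in_comp_noX u v x y : in_comp u v -> in_comp x y ->
  track_of u = track_of x -> track_of v = track_of y -> (vertex_key u < vertex_key x)%O -> ~ (vertex_key y < vertex_key v)%O.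
Proof.
move=> [uv auv] [xy axy] /track_of_eq[_ tux] /track_of_eq[_ tvy] /vertex_key_lt ux /vertex_key_lt.
have := adjO_span auv; have := adjO_span axy; rewrite /span2 => s1 s2.
rewrite uv xy; case: ux => [lt|[E lt]|[E Ek ltux]].
- by case=> [|[]|[]]; lia.
- case=> [|[_ lt']|[_ Ek]]; [lia| |by rewrite Ek ltxx in lt].
  by have := lt_trans lt lt'; rewrite ltxx.
case=> [|[_]|[_ _ ltyv]]; [lia|by rewrite Ek ltxx|].
have Eux : level u.2 = level x.2 by lia.
have Evy : level v.2 = level y.2 by lia.
case: ltux ltyv => [|[_ ltux]]; [lia|case => [|[_ ltyv]]; first lia].
by have := adjO_noX auv axy Eux Evy ltux; rewrite leNgt ltyv.
Qed.

Lemma triangle_isEdge a u : u \in triangle_at a -> isEdge a.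
Proof. by rewrite /triangle_at /isEdge; case: (kind_at a). Qed.

(** Equal palettes put both triangles in one class. If they lie in one component, either they
    coincide, and distinct vertices have levels incongruent modulo 5, or [rank_lt_mono] contradicts
    the order of [u] and [x]. *)
Lemma parent_noX u v x y : parent_of u v -> parent_of x y ->
  track_of u = track_of x -> track_of v = track_of y -> (vertex_key u < vertex_key x)%O -> ~ (vertex_key y < vertex_key v)%O.
Proof.
move=> [b Ev ub] [c Ey xc] /track_of_eq[pux tux] /track_of_eq[pvy tvy] /vertex_key_lt ux /vertex_key_lt.
have ckE d g : comp_key (d :: g) = comp_key g ++ rcons (rank d.1) (d.2 : nat)%:R by [].
have szE (d : address * bool) g : size (d :: g) = (size g).+1 by [].
rewrite Ev Ey in pvy *; rewrite /= in pvy; rewrite !ckE !szE.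
have ow : odd (window c.1) = odd (window b.1).
  by move: pvy; rewrite pux; have := palette_lt5 x.1; case: (odd _); case: (odd _) => //=; lia.
case: ux => [lt|[E lt]|[E Ek ltux]].
- by case=> [|[? _]|[? _ _]]; lia.
- have Es : size (comp_key x.1) = size (comp_key u.1) by rewrite !size_comp_key E.
  case=> [|[_]|[_ /eqP]]; first lia.
    rewrite ltkey_cat // => /orP[lt'|/andP[/eqP Ek]]; last by rewrite Ek ltxx in lt.
    by have := lt_trans lt lt'; rewrite ltxx.
  by rewrite eqseq_cat // => /andP[/eqP Ek]; rewrite Ek ltxx in lt.
move=> H.
have {H} lecb : rank c.1 = rank b.1 \/ (rank c.1 < rank b.1 :> key)%O.
  have Es : size (rcons (rank c.1) (c.2 : nat)%:R) = size (rcons (rank b.1) (b.2 : nat)%:R) by [].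
  case: H => [|[_]|[_ /eqP + _]]; first by rewrite E ltnn.
    rewrite Ek ltkey_cat // eqxx ltxx orFb andTb -!cats1 ltkey_cat // => /orP[|/andP[/eqP]]; [by right|by left].
  by rewrite Ek eqseq_cat // eqxx andTb eqseq_rcons => /andP[/eqP-> _]; left.
case: lecb => [/(rank_inj (triangle_isEdge xc) (triangle_isEdge ub)) cb|lt].
  rewrite cb in xc; have [Eux|nux] := eqVneq u.2 x.2.
    by move: ltux; rewrite Eux ltnn ltxx => -[|[]].
  by have := adjO_span (adj_triangle ub xc nux); rewrite /span2; clear -tux; lia.
have := rank_lt_mono (triangle_isEdge xc) (triangle_isEdge ub) ow xc ub (esym tux) lt.
case: ltux => [ltux|[Eux ltux]] [|[Exu le]].
- by rewrite ltnNge (ltnW ltux).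
- by rewrite Exu ltnn in ltux.
- by rewrite Eux ltnn.
- by rewrite leNgt ltux in le.
Qed.

Definition parents_of k : seq nat :=
  match k with Root => [:: 0; 1; 2] | Slot _ i j => [:: i; j] | Edge _ _ i => [:: i] end%N.
Definition parents a := parents_of (kind_at a).

Lemma parents_lt3 a i : i \in parents a -> (i < 3)%N.
Proof.
elim: a i => [|d p IH] i; first by rewrite !inE => /or3P[] /eqP->.
move: IH; rewrite /parents /=; case: (kind_at p) => [|c i1 j|l r i1]; case: d => /= IH;
  rewrite !inE => H; first
    [ by case/orP: H => /eqP->
    | by apply: IH; rewrite !inE; case/orP: H => ->; rewrite ?orbT
    | by apply: IH; rewrite !inE H ?orbT].
Qed.

Definition corners (x : uvertex) : seq uvertex :=
  [seq (x.1, e) | e <- end_addrs x.2] ++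
  (if x.1 is b :: g then [seq (g, nth [::] (triangle_at b.1) i) | i <- parents x.2] else [::]).

Definition adjU x y := (x \in corners y) || (y \in corners x).

Lemma cornersP x y : valid x -> y \in corners x -> in_comp y x \/ parent_of y x.
Proof.
case: x => [g a]; rewrite mem_cat => /= leveled /orP[/mapP[e ea ->]|].
  by left; split => //; rewrite /adjO ea.
case: g leveled => // b g /andP[eb _] /mapP[i /parents_lt3 i3 ->]; right; exists b => //=.
by rewrite mem_nth //; move: eb; rewrite /isEdge /triangle_at; case: (kind_at b.1).
Qed.

Lemma in_comp_sym x y : in_comp x y -> in_comp y x.
Proof. by case=> E a; split; rewrite // adjO_sym. Qed.

Lemma adjUP x y : valid x -> valid y -> adjU x y ->
  [\/ in_comp x y, parent_of x y | parent_of y x].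
Proof.
move=> leveled vy /orP[/(cornersP vy)[]|/(cornersP leveled)[]]; [by constructor 1|by constructor 2| |by constructor 3].
by move/in_comp_sym; constructor 1.
Qed.

Lemma parent_palette x y : parent_of x y -> palette y.1 = ((palette x.1 + 1) %% 5)%N \/ palette y.1 = ((palette x.1 + 2) %% 5)%N.
Proof. by case=> b -> _ /=; case: (odd _); [right|left]; rewrite -addnA. Qed.

Lemma adjU_track x y : valid x -> valid y -> adjU x y -> track_of x <> track_of y.
Proof.
move=> leveled vy /(adjUP leveled vy)[[_ /adjO_span]|/parent_palette|/parent_palette] H /track_of_eq[];
  have := palette_lt5 x.1; have := palette_lt5 y.1; move: H; rewrite /span2.
- by move=> *; lia.
- by move=> H *; lia.
- by move=> H *; lia.
Qed.

(** Component edges keep the palette, parent edges change it. Two steps from parent to child add 2,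
    3 or 4, never 0 modulo 5, so parent edges between the same palettes point the same way. *)
Lemma adjU_noX u v x y : valid u -> valid v -> valid x -> valid y ->
  adjU u v -> adjU x y -> track_of u = track_of x -> track_of v = track_of y ->
  (vertex_key u < vertex_key x)%O -> ~ (vertex_key y < vertex_key v)%O.
Proof.
move=> vu vv leveled vy /(adjUP vu vv) uv /(adjUP leveled vy) xy tux tvy ux yv.
have [[pux _] [pvy _]] := (track_of_eq tux, track_of_eq tvy).
have P a b : parent_of a b -> palette a.1 <> palette b.1.
  by move=> /parent_palette; have := palette_lt5 a.1; clear; lia.
have P2 a b c d : parent_of a b -> parent_of c d -> palette a.1 = palette d.1 -> palette b.1 = palette c.1 -> False.
  by move=> /parent_palette + /parent_palette; have := palette_lt5 a.1; have := palette_lt5 b.1; clear; lia.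
case: uv => [uv|uv|uv]; case: xy => [xy|xy|xy].
- exact: in_comp_noX uv xy tux tvy ux yv.
- by apply: (P _ _ xy); rewrite -pux -pvy uv.1.
- by apply: (P _ _ xy); rewrite -pux -pvy uv.1.
- by apply: (P _ _ uv); rewrite pux pvy xy.1.
- exact: parent_noX uv xy tux tvy ux yv.
- exact: P2 uv xy pux pvy.
- by apply: (P _ _ uv); rewrite pux pvy xy.1.
- by apply: P2 uv xy pvy pux.
- exact: parent_noX xy uv (esym tvy) (esym tux) yv ux.
Qed.

(** * Embedding into the universal graph *)

Local Close Scope ring_scope.

Lemma child_faces w : valid w -> w.1 != [::] ->
  exists x0 x1 x2, [/\ corners w = [:: x0; x1; x2],
    exists2 w', valid w' & corners w' =i [:: w; x1; x2],
    exists2 w', valid w' & corners w' =i [:: w; x0; x2] &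
    exists2 w', valid w' & corners w' =i [:: w; x0; x1]].
Proof.
case: w => -[|b g] a //= vg _; rewrite /corners /= /end_addrs /ends /parents.
have vc d : valid (b :: g, d :: a) by [].
have P3 (x y z : uvertex) : [:: x; y; z] =i [:: y; x; z] by move=> u; rewrite !inE orbCA.
case E: (kind_at a) => [|c i j|l r i] /=.
- do 3!eexists; split; first by [].
  + by exists (b :: g, DL :: a) => // x; rewrite /corners /= /end_addrs /ends /parents /= E.
  + by exists (b :: g, DM :: a) => // x; rewrite /corners /= /end_addrs /ends /parents /= E.
  + by exists (b :: g, DR :: a) => // x; rewrite /corners /= /end_addrs /ends /parents /= E.
- do 3!eexists; split; first by [].
  + by exists (b :: g, DM :: a) => // x; rewrite /corners /= /end_addrs /ends /parents /= E.
  + by exists (b :: g, DR :: a) => // x; rewrite /corners /= /end_addrs /ends /parents /= E.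
  + by exists (b :: g, DL :: a) => // x; rewrite /corners /= /end_addrs /ends /parents /= E /= P3.
- do 3!eexists; split; first by [].
  + by exists (b :: g, DR :: a) => // x; rewrite /corners /= /end_addrs /ends /parents /= E.
  + by exists (b :: g, DL :: a) => // x; rewrite /corners /= /end_addrs /ends /parents /= E /= P3.
  (* The face avoiding the parent triangle is the root face of a new component. *)
  + exists ((a, false) :: b :: g, [::]); first by rewrite /valid /= /isEdge E.
    by move=> x; rewrite /corners /= /triangle_at E /= P3.
Qed.

Lemma child_face w t : valid w -> w.1 != [::] -> uniq (corners w) -> t \in corners w ->
  exists2 w', valid w' & corners w' =i w :: [seq y <- corners w | y != t].
Proof.
move=> vw nw; have [x0 [x1 [x2 [-> [w0 v0 c0] [w1 v1 c1] [w2 v2 c2]]]]] := child_faces vw nw.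
rewrite /= !inE => /andP[/norP[n01 n02] /andP[n12 _]] /or3P[] /eqP->.
- by exists w0 => //; rewrite eqxx /= (eq_sym x1) (eq_sym x2) n01 n02.
- by exists w1 => //; rewrite eqxx /= (eq_sym x2) n01 n12.
- by exists w2 => //; rewrite eqxx /= n02 n12.
Qed.

Section Embedding.
Variables (T : finType) (e : rel T).
Hypotheses (e_sym : symmetric e) (e_irr : irreflexive e).

Definition common_nbrs (C : {set T}) := [set v | [forall u in C, e v u]].

Hypothesis cn2 : forall C : {set T}, #|C| = 3 -> clique e C -> #|common_nbrs C| <= 2.

Definition face_of (A : {set T}) (phi : T -> uvertex) (C : {set T}) w :=
  [/\ valid w, corners w =i [seq phi x | x in C] & w \notin [seq phi x | x in A]].

(** The last clause is a budget: each triangle keeps a free face for every common neighbour it may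
    still receive. Closure under corners serves to show that newly created faces are free. *)
Definition partial_embedding (A : {set T}) (phi : T -> uvertex) :=
  [/\ {in A &, injective phi},
      forall x, x \in A -> valid (phi x) /\ {subset corners (phi x) <= [seq phi y | y in A]},
      forall x y, x \in A -> y \in A -> e x y -> adjU (phi x) (phi y) &
      forall C : {set T}, C \subset A -> #|C| = 3 -> clique e C -> exists ws,
        [/\ uniq ws, forall w, w \in ws -> face_of A phi C w &
            2 <= size ws + #|common_nbrs C :&: A|]].

Lemma partial_embedding_base (A : {set T}) : #|A| = 3 -> exists phi, partial_embedding A phi.
Proof.
move=> cA; have := enum_uniq A; have := mem_enum A; have := cA; rewrite cardE.
case: (enum A) => [|a [|b [|c [|]]]] //= _ mA /and3P[]; rewrite !inE => /norP[ab ac] bc _.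
have eA x : x \in A = [|| x == a, x == b | x == c] by rewrite -mA !inE.
(* These addresses have levels 0, 1 and 2 and form the triangle of the edge face [[:: DL; DM]]; its
   two sides are the free faces. *)
pose phi x : uvertex := if x == a then ([::], [::]) else if x == b then ([::], [:: DM]) else
  ([::], [:: DL; DM]).
have pa : phi a = ([::], [::]) by rewrite /phi eqxx.
have pb : phi b = ([::], [:: DM]) by rewrite /phi eq_sym (negPf ab) eqxx.
have pc : phi c = ([::], [:: DL; DM]) by rewrite /phi !(eq_sym c) (negPf ac) (negPf bc).
have im (B : {set T}) : B =i A -> [seq phi x | x in B] =i [:: phi a; phi b; phi c].
  move=> BA y; rewrite !inE; apply/imageP/or3P => [[x]|].
    rewrite BA eA => /or3P[] /eqP-> ->; by [constructor 1|constructor 2|constructor 3].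
  by case=> /eqP->; [exists a|exists b|exists c] => //; rewrite BA eA eqxx ?orbT.
exists phi; split.
- move=> x y; rewrite !eA => /or3P[] /eqP-> /or3P[] /eqP-> //; rewrite ?pa ?pb ?pc //.
- move=> x; rewrite eA => /or3P[] /eqP->; rewrite ?pa ?pb ?pc; split => // y;
  rewrite im // ?pa ?pb ?pc /corners /= ?inE //.
  by move=> ->.
  by case/orP => ->; rewrite ?orbT.
- move=> x y; rewrite !eA => /or3P[] /eqP-> /or3P[] /eqP->; rewrite ?e_irr ?pa ?pb ?pc //.
- move=> C CA C3 _; have EC : C = A.
    by apply/eqP; rewrite eqEcard CA C3 cA.
  rewrite EC; pose w s : uvertex := ([:: ([:: DL; DM], s)], [::]).
  exists [:: w false; w true]; split => // x x2.
  have [s ->] : exists s, x = w s.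
    by move: x2; rewrite !inE => /orP[] /eqP->; [exists false|exists true].
  split => // [y|]; rewrite im // pa pb pc /corners //=.
  by rewrite !inE orbA orbAC -orbA.
Qed.


Lemma partial_embedding_step (A C : {set T}) v phi :
  v \notin A -> C \subset A -> #|C| = 3 -> clique e C ->
  (forall u, u \in A -> e v u = (u \in C)) ->
  partial_embedding A phi -> exists phi', partial_embedding (v |: A) phi'.
Proof.
move=> vA CA C3 cC ev [inj vc adj faces].
have vcn : v \in common_nbrs C.
  by rewrite inE; apply/forall_inP => u uC; rewrite ev // (subsetP CA).
have [ws [uws wsP szws]] := faces C CA C3 cC.
(* As [v] is a common neighbour outside [A], at most one lies in [A], so a free face [w] is left for
   [v]. *)
have cnA : #|common_nbrs C :&: A| <= 1.
  have := cn2 C3 cC; rewrite (cardsD1 v) vcn add1n ltnS; apply: leq_trans.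
  apply/subset_leq_card/subsetP => x; rewrite !inE => /andP[-> xA]; rewrite andbT.
  by apply: contraNneq vA => <-.
case: ws uws wsP szws => [|w ws] /=; first by lia.
move=> /andP[wws uws] wsP szws.
have [vw cw wA] := wsP w (mem_head _ _).
have injC : {in C &, injective phi} by move=> x y /(subsetP CA) xA /(subsetP CA); apply: inj.
have uC : uniq [seq phi x | x in C].
  by rewrite map_inj_in_uniq ?enum_uniq // => x y; rewrite !mem_enum; apply: injC.
have sC : size [seq phi x | x in C] = 3 by rewrite size_map -cardE.
(* In the component with empty path a vertex has at most two corners, but [w] has three. *)
have nw : w.1 != [::].
  have : size [seq phi x | x in C] <= size (corners w).
    by apply: uniq_leq_size uC _ => x; rewrite cw.
  rewrite sC /corners size_cat; case: (w.1) => //=; rewrite addn0 size_map /end_addrs size_map.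
  by rewrite /ends; case: (kind_at w.2).
have ucw : uniq (corners w).
  apply: (leq_size_uniq uC) => [x|]; rewrite ?cw // sC.
  by have [x0 [x1 [x2 [-> _ _ _]]]] := child_faces vw nw.
pose phi' x := if x == v then w else phi x.
have pv : phi' v = w by rewrite /phi' eqxx.
have pA x : x \in A -> phi' x = phi x.
  by rewrite /phi'; case: eqP => // ->; rewrite (negPf vA).
have imA (B : {set T}) : B \subset A -> [seq phi' x | x in B] =i [seq phi x | x in B].
  move=> /subsetP BA y; apply/imageP/imageP => -[x xB ->]; exists x => //; by rewrite pA ?BA.
have imv : [seq phi' x | x in v |: A] =i w :: [seq phi x | x in A].
  move=> y; rewrite inE; apply/imageP/orP => [[x] |[/eqP->|/imageP[x xA ->]]].
  - rewrite !inE => /orP[/eqP->|xA] ->; first by left; rewrite pv.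
    by right; rewrite pA //; apply/imageP; exists x.
  - by exists v; rewrite ?inE ?eqxx ?pv.
  - by exists x; rewrite ?inE ?xA ?orbT ?pA.
have phi_neq x : x \in A -> w != phi x.
  by move=> xA; apply: contraNneq wA => ->; apply/imageP; exists x.
have memC x : x \in A -> phi x \in [seq phi x | x in C] -> x \in C.
  by move=> xA /imageP[y yC /inj ->] //; rewrite (subsetP CA).
exists phi'; split.
- move=> x y; rewrite !inE => /orP[/eqP->|xA] /orP[/eqP->|yA] //; rewrite ?pv ?pA //.
  + by move/eqP; rewrite (negPf (phi_neq _ yA)).
  + by move/esym/eqP; rewrite (negPf (phi_neq _ xA)).
  + exact: inj.
- move=> x /setU1P[->|xA].
    rewrite pv; split => // y; rewrite cw imv inE => /imageP[z zC ->].
    by rewrite (map_f phi) ?orbT // mem_enum (subsetP CA).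
  have [leveled sx] := vc x xA; rewrite pA //; split => // y /sx.
  by rewrite imv inE => ->; rewrite orbT.
- move=> x y /setU1P[->|xA] /setU1P[->|yA]; rewrite ?e_irr ?pv ?pA //.
  + by rewrite ev // => yC; rewrite /adjU cw orbC map_f // mem_enum.
  + by rewrite e_sym ev // => yC; rewrite /adjU cw map_f // mem_enum.
  + exact: adj.
move=> C' C'A C'3 cC'.
have [vC'|vC'] := boolP (v \in C'); last first.
  have {}C'A : C' \subset A.
    apply/subsetP => x xC'; have /setU1P[E|//] := subsetP C'A x xC'.
    by rewrite -E xC' in vC'.
  (* [C] loses the free face [w] and gains the common neighbour [v]; other triangles of [A] keep
     their free faces. *)
  have [EC|nC] := eqVneq C' C.
    subst C'; exists ws; split => // [w' w'ws|].
      have [v' c' n'] := wsP w' (mem_behead (s := w :: ws) w'ws).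
      split => // [x|]; first by rewrite c' imA.
      by rewrite imv inE negb_or n' andbT; apply: contraNneq wws => <-.
    have -> : common_nbrs C :&: (v |: A) = v |: (common_nbrs C :&: A).
      by apply/setP => x; rewrite !inE; case: eqP => //= ->; move: vcn; rewrite inE => ->.
    by rewrite cardsU1 inE (negPf vA) andbF addnA addn1.
  have [ws' [uws' ws'P szws']] := faces C' C'A C'3 cC'.
  exists ws'; split => // [w' /ws'P[v' c' n']|]; last first.
    apply: (leq_trans szws'); rewrite leq_add2l; apply/subset_leq_card/setIS.
    exact: subsetUr.
  split => // [x|]; first by rewrite c' imA.
  rewrite imv inE negb_or n' andbT; apply: contraNneq nC => E.
  rewrite eqEcard C'3 C3 leqnn andbT; apply/subsetP => x xC'.
  by apply: memC; rewrite ?(subsetP C'A) // -cw -E c' map_f // mem_enum.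
have sub x : x \in C' -> x != v -> x \in C.
  move=> xC' xv; rewrite -ev; first by apply: cC'; rewrite // eq_sym.
  by have /setU1P[E|//] := subsetP C'A x xC'; rewrite E eqxx in xv.
have cD : #|C' :\ v| = 2 by apply/eqP; rewrite -eqSS -C'3 (cardsD1 v C') vC'.
have DC : C' :\ v \subset C by apply/subsetP => x /setD1P[xv xC']; apply: sub.
(* [C'] is [v] with two vertices of [C], and [c] is the third. The face at [w] omitting [phi c] is
   free, and [c] is a common neighbour of [C']: two in total. *)
have [c cC1] : exists c, c \in C :\: (C' :\ v).
  by apply/set0Pn; rewrite -card_gt0 cardsD (setIidPr DC) C3 cD.
have := cC1; rewrite !inE negb_and negbK => /andP[ncC' cinC].
have cA : c \in A by apply: subsetP cinC.
have cv : c != v by apply: contraNneq vA => <-.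
rewrite (negPf cv) /= in ncC'.
have EC x : x \in C -> x != c -> x \in C'.
  have /eqP <- : c |: (C' :\ v) == C.
    rewrite eqEcard C3 cardsU1 cD !inE (negPf ncC') andbF andbT.
    by rewrite subUset sub1set cinC.
  by rewrite !inE => /orP[/eqP->|/andP[]//]; rewrite eqxx.
have pcw : phi c \in corners w by rewrite cw map_f // mem_enum.
have [w' vw' cw'] := child_face vw nw ucw pcw.
exists [:: w']; split => // [x|].
  rewrite inE => /eqP->; split => // [y|].
    rewrite cw' inE mem_filter cw; apply/orP/imageP.
      case=> [/eqP->|/andP[yc /imageP[z zC Ey]]]; first by exists v; rewrite ?pv.
      subst y; have zA := subsetP CA _ zC.
      exists z; last by rewrite pA.
      by apply: EC => //; apply: contraNneq yc => ->.
    case=> z zC' ->; have [->|zv] := eqVneq z v; first by left; rewrite pv.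
    have zC := sub z zC' zv; have zA := subsetP CA _ zC.
    right; rewrite pA // map_f ?mem_enum // andbT.
    by apply: contraNneq ncC' => /inj <-.
  rewrite imv inE negb_or; have wcw' : w \in corners w' by rewrite cw' mem_head.
  apply/andP; split.
    apply: contraNneq wA => E; move: wcw'; rewrite E cw => /imageP[z zC ->].
    by rewrite map_f // mem_enum (subsetP CA).
  (* Were [w'] in the image, its corner [w] would be too. *)
  apply/imageP => -[z zA E]; case/negP: wA; have [_ sx] := vc z zA.
  by apply: sx; rewrite -E.
rewrite add1n ltnS card_gt0; apply/set0Pn; exists c.
rewrite !inE cA orbT andbT; apply/forall_inP => x xC'.
have [->|xv] := eqVneq x v; first by rewrite e_sym ev.
apply: cC => //; first exact: sub.
by apply: contraNneq ncC' => ->.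
Qed.

Lemma ktree_embedding A : ktree_on e 3 A -> exists phi, partial_embedding A phi.
Proof.
elim=> [B B3 _|B C v _ [phi pe] vB CB C3 cC ev]; first exact: partial_embedding_base.
exact: (partial_embedding_step vB CB C3 cC ev pe).
Qed.

End Embedding.

(** * Pulling the layout back to the given graph *)

Lemma track_layout_pullback (T : finType) (e : rel T) (phi : T -> uvertex) :
  injective phi -> (forall x, valid (phi x)) ->
  (forall x y, e x y -> adjU (phi x) (phi y)) -> track_layout e 25.
Proof.
move=> inj vphi adj.
pose tr x : 'I_25 := Ordinal (track_of_lt25 (phi x)).
(* Counting smaller keys turns the order on keys into natural numbers. *)
pose pos x := #|[set y | (vertex_key (phi y) < vertex_key (phi x))%O]|.
have mono x y : (vertex_key (phi x) < vertex_key (phi y))%O -> pos x < pos y.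
  move=> xy; apply/proper_card/properP; split.
    by apply/subsetP => z; rewrite !inE => /lt_trans; apply.
  by exists x; rewrite !inE ?ltxx.
have posE x y : pos x < pos y -> (vertex_key (phi x) < vertex_key (phi y))%O.
  move=> lt; case: ltgtP => // [/mono|E]; first by rewrite ltnNge ltnW.
  by move: lt; rewrite /pos E ltnn.
exists tr, pos; split; first split.
- move=> u v uv; apply/eqP => /(congr1 val) /=.
  exact: adjU_track (adj _ _ uv).
- move=> u v _ E; apply/inj/vertex_key_inj => //.
  by case: (ltgtP (vertex_key (phi u)) (vertex_key (phi v))) => // /mono; rewrite E ltnn.
move=> u v x y [uv [xy [/(congr1 val) /= ux [/(congr1 val) /= vy [_ [/posE lux /posE lyv]]]]]].
exact: (adjU_noX _ _ _ _ (adj _ _ uv) (adj _ _ xy) ux vy lux lyv).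
Qed.

Theorem theorem6 (T : finType) (e : rel T) :
  symmetric e -> irreflexive e -> planar_3tree e -> track_number_le e 25.
Proof.
move=> e_sym e_irr pe; exists 25 => //.
have cn2 (C : {set T}) (C3 : #|C| = 3) (cC : clique e C) : #|common_nbrs e C| <= 2.
  exact: planar_3tree_common_nbrs.
have [phi [inj vc adj _]] := ktree_embedding e_sym e_irr cn2 pe.1.
apply: (@track_layout_pullback _ _ phi).
- by move=> x y; apply: inj; rewrite inE.
- by move=> x; have [] := vc x (in_setT x).
- by move=> x y; apply: adj; rewrite inE.
Qed.
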